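(* Any real finite-dimensional commutative graded division algebra is equivalent to exactly one of the following: (1) a naturally graded real group algebra $\mathbb{R}G$, for a finite abelian group $G$; (2) a naturally graded complex group algebra $\mathbb{C}G$, viewed as a real algebra, for a finite abelian group $G$; (3) a tensor product of graded algebras $\mathcal{C}(2^m;-1)\otimes\mathbb{R}G$, for a natural number $m\ge 1$ and a finite abelian group $G$. (Here groups $G$ are taken up to isomorphism.)
   Context: A $G$-graded real algebra $R=\bigoplus_{g\in G}R_g$ ($G$ an abelian group, $R_gR_h\subset R_{gh}$, $R$ associative and unital) is a graded division algebra if every nonzero homogeneous element is invertible. The support $\{g:R_g\ne0\}$ is always assumed to be all of $G$, so $G$ is finite when $R$ is finite-dimensional. A $G$-graded division algebra $R$ and a $G'$-graded division algebra $R'$ are equivalent if there are an isomorphism of $\mathbb R$-algebras $\varphi:R\to R'$ and a group isomorphism $\alpha:G\to G'$ with $\varphi(R_g)=R'_{\alpha(g)}$ for all $g\in G$. Tensor products over $\mathbb R$ of a $G_1$-graded and a $G_2$-graded algebra are graded by $G_1\times G_2$ via $(R_1\otimes R_2)_{(g_1,g_2)}=(R_1)_{g_1}\otimes(R_2)_{g_2}$. The natural grading of a group algebra $FG$ is $(FG)_g=Fg$. For a natural number $n>1$ and $\varepsilon=\pm1$, $\mathcal C(n;\varepsilon)$ is the real algebra generated by one element $x$ with defining relation $x^n=\varepsilon I$ ($I$ the identity element), graded by the cyclic group of order $n$ with generator $g$ by $\deg x=g$. *)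

(* Defs.v *)
From HB Require Import structures.
From mathcomp Require Import all_boot all_order all_algebra all_field.
From mathcomp Require Import reals complex.

Set Implicit Arguments.
Unset Strict Implicit.
Unset Printing Implicit Defensive.

Import GRing.Theory.
Local Open Scope ring_scope.

(* Abelian groups are written additively, so that R_g R_h \subset R_(gh) reads
   c g * c h <= c (g + h).  The grading group may be infinite: the sum of the
   c g is direct because each of them meets every finite sum of others in 0,
   and it is everything because each element lies in some finite sum. *)
Definition is_grading (F : fieldType) (A : falgType F) (G : zmodType)
    (c : G -> {vspace A}) : Prop :=
  [/\ forall g h, (c g * c h <= c (g + h)%R)%VS,
      forall x : A, exists s : seq G, x \in (\sum_(g <- s) c g)%VS
    & forall g (s : seq G), g \notin s ->
        (c g :&: \sum_(h <- s) c h = 0)%VS].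

Record gradedAlg (F : fieldType) : Type := GradedAlg {
  gr_alg :> falgType F;
  gr_group : zmodType;
  gr_comp : gr_group -> {vspace gr_alg};
  gr_axiom : is_grading gr_comp }.

Definition graded_division (F : fieldType) (A : gradedAlg F) : Prop :=
  (forall (g : gr_group A) (x : A),
     x \in gr_comp g -> x != 0 -> x \is a GRing.unit) /\
  (forall g : gr_group A, gr_comp g != 0%VS).

Definition gr_equiv (F : fieldType) (A B : gradedAlg F) : Prop :=
  exists (phi : 'AHom(A, B)) (alpha : {additive gr_group A -> gr_group B}),
    [/\ bijective phi, bijective alpha
      & forall g, (phi @: gr_comp g = gr_comp (alpha g))%VS].

Definition group_iso (G H : zmodType) : Prop :=
  exists f : {additive G -> H}, bijective f.

Lemma memv_sum_seq (F : fieldType) (V : vectType F) (I : Type) (s : seq I)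
    (c : I -> {vspace V}) (u : I -> V) :
  (forall i, u i \in c i) -> \sum_(i <- s) u i \in (\sum_(i <- s) c i)%VS.
Proof.
move=> cu; elim: s => [|i s IH]; first by rewrite !big_nil mem0v.
by rewrite !big_cons memv_add.
Qed.

Lemma subv_sum_seq (F : fieldType) (V : vectType F) (I : eqType) (s : seq I)
    (c : I -> {vspace V}) (U : {vspace V}) :
  {in s, forall i, (c i <= U)%VS} -> (\sum_(i <- s) c i <= U)%VS.
Proof.
elim: s => [|i s IH] cU; first by rewrite big_nil sub0v.
rewrite big_cons subv_add cU ?mem_head //=.
by apply: IH => j js; apply: cU; rewrite inE js orbT.
Qed.

Lemma sumv_sup_seq (F : fieldType) (V : vectType F) (I : eqType) (s : seq I)
    (c : I -> {vspace V}) (i : I) :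
  i \in s -> (c i <= \sum_(j <- s) c j)%VS.
Proof.
elim: s => // j s IH; rewrite inE big_cons => /predU1P[->|/IH].
  exact: addvSl.
by move/subv_trans; apply; apply: addvSr.
Qed.

Lemma linear_comb (F : fieldType) (U V : lmodType F) (I : finType)
    (f : U -> V) (k : I -> F) (u : I -> U) :
  linear f -> f (\sum_i k i *: u i) = \sum_i k i *: f (u i).
Proof.
move=> fL; have f0 : f 0 = 0.
  by have := fL (-1) 0 0; rewrite scaler0 addr0 scaleN1r addNr.
rewrite (big_morph f (id1 := 0) (op1 := +%R)) => [|x y|//].
  by apply: eq_bigr => i _; rewrite -[_ *: u i]addr0 fL f0 addr0.
by rewrite -[x]scale1r fL !scale1r.
Qed.

(* The group algebra K G, over the base field F; K is a finite-dimensional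
   F-algebra, so that C G is available as a real algebra. *)
Definition groupAlg (F : fieldType) (K : falgType F) (G : finZmodType) : Type :=
  {ffun G -> K}.

Section GroupAlg.
Variables (F : fieldType) (K : falgType F) (G : finZmodType).
Local Notation KG := (groupAlg K G).

HB.instance Definition _ := Vector.copy KG {ffun G -> K}.

(* The element a g of K G. *)
Definition gsingle (g : G) (a : K) : KG := [ffun h => if h == g then a else 0].

Definition gmul (u v : KG) : KG :=
  [ffun g => \sum_(h : G) u h * v (g - h)].

Fact gmulA : associative gmul.
Proof.
move=> u v w; apply/ffunP=> g; rewrite !ffunE.
transitivity (\sum_h \sum_k u h * (v k * w (g - h - k))).
  by apply: eq_bigr => h _; rewrite ffunE mulr_sumr.
transitivity (\sum_k \sum_h u h * v (k - h) * w (g - k)); last first.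
  by apply: eq_bigr => k _; rewrite ffunE mulr_suml.
rewrite [RHS]exchange_big /=; apply: eq_bigr => h _.
rewrite [RHS](reindex_inj (addrI h)) /=; apply: eq_bigr => k _.
by rewrite mulrA [h + k]addrC addrK opprD addrA addrAC.
Qed.

Fact gmul1l : left_id (gsingle 0 1) gmul.
Proof.
move=> u; apply/ffunP=> g; rewrite ffunE (bigD1 0) //= big1 => [|h nz].
  by rewrite ffunE eqxx mul1r subr0 addr0.
by rewrite ffunE (negPf nz) mul0r.
Qed.

Fact gmul1r : right_id (gsingle 0 1) gmul.
Proof.
move=> u; apply/ffunP=> g; rewrite ffunE (bigD1 g) //= big1 => [|h nz].
  by rewrite ffunE subrr eqxx mulr1 addr0.
by rewrite ffunE subr_eq0 eq_sym (negPf nz) mulr0.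
Qed.

Fact gmulDl : left_distributive gmul +%R.
Proof.
move=> u v w; apply/ffunP=> g; rewrite !ffunE -big_split /=.
by apply: eq_bigr => h _; rewrite ffunE mulrDl.
Qed.

Fact gmulDr : right_distributive gmul +%R.
Proof.
move=> u v w; apply/ffunP=> g; rewrite !ffunE -big_split /=.
by apply: eq_bigr => h _; rewrite ffunE mulrDr.
Qed.

Fact gone_neq0 : gsingle 0 1 != 0.
Proof. by apply/eqP=> /ffunP/(_ 0)/eqP; rewrite !ffunE eqxx oner_eq0. Qed.

HB.instance Definition _ :=
  GRing.Zmodule_isNzRing.Build KG gmulA gmul1l gmul1r gmulDl gmulDr gone_neq0.

Fact gscaleAl (k : F) (u v : KG) : k *: (u * v) = k *: u * v.
Proof.
apply/ffunP=> g; rewrite !ffunE scaler_sumr.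
by apply: eq_bigr => h _; rewrite ffunE scalerAl.
Qed.

Fact gscaleAr (k : F) (u v : KG) : k *: (u * v) = u * (k *: v).
Proof.
apply/ffunP=> g; rewrite !ffunE scaler_sumr.
by apply: eq_bigr => h _; rewrite ffunE scalerAr.
Qed.

HB.instance Definition _ := GRing.Lmodule_isLalgebra.Build F KG gscaleAl.
HB.instance Definition _ := GRing.Lalgebra_isAlgebra.Build F KG gscaleAr.
HB.instance Definition _ := Algebra_isFalgebra.Build F KG.

Fact gsingle_is_linear (g : G) : linear (gsingle g).
Proof.
move=> k a b; apply/ffunP=> h; rewrite !ffunE.
by case: eqP => // _; rewrite scaler0 addr0.
Qed.
HB.instance Definition _ (g : G) := GRing.isSemilinear.Build F K KG _
  (gsingle g) (GRing.semilinear_linear (gsingle_is_linear g)).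

Lemma gsingleM (g h : G) (a b : K) :
  gsingle g a * gsingle h b = gsingle (g + h) (a * b).
Proof.
apply/ffunP=> k; rewrite !ffunE (bigD1 g) //= big1 => [|l nl]; last first.
  by rewrite ffunE (negPf nl) mul0r.
rewrite !ffunE eqxx addr0 subr_eq [h + g]addrC.
by case: eqP => // _; rewrite mulr0.
Qed.

(* The line K g. *)
Definition groupAlg_comp (g : G) : {vspace KG} := limg (linfun (gsingle g)).

Lemma groupAlg_compP (g : G) (x : KG) :
  reflect (exists a, x = gsingle g a) (x \in groupAlg_comp g).
Proof.
apply: (iffP memv_imgP) => [[a _ ->]|[a ->]]; exists a;
  by rewrite ?memvf ?lfunE.
Qed.

Fact groupAlg_grading : is_grading groupAlg_comp.
Proof.
split=> [g h|x|g s gs].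
- apply/prodvP=> _ _ /groupAlg_compP[a ->] /groupAlg_compP[b ->].
  by apply/groupAlg_compP; exists (a * b); apply: gsingleM.
- exists (enum G).
  have -> : x = \sum_(g <- enum G) gsingle g (x g).
    apply/ffunP=> h; rewrite big_enum sum_ffunE (bigD1 h) //= big1 ?addr0.
      by rewrite ffunE eqxx.
    by move=> g; rewrite ffunE eq_sym => /negPf->.
  by apply: memv_sum_seq => g; apply/groupAlg_compP; exists (x g).
apply/eqP; rewrite -subv0; apply/subvP=> x; rewrite memv_cap memv0.
case/andP=> /groupAlg_compP[a ->] xs.
suff : gsingle g a g = 0 by rewrite ffunE eqxx => ->; rewrite linear0.
elim: s gs (gsingle g a) xs => [_ u|h s IH].
  by rewrite big_nil memv0 => /eqP->; rewrite ffunE.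
rewrite inE negb_or big_cons => /andP[gh /IH{}IH] u.
case/memv_addP=> _ /groupAlg_compP[b ->] [v /IH v0 ->].
by rewrite !ffunE v0 (negPf gh) addr0.
Qed.

Definition gr_groupAlg : gradedAlg F := GradedAlg groupAlg_grading.

End GroupAlg.

Section ComplexAlg.
Variable R : rcfType.
Local Notation C := (Rcomplex R).

Fact Rcomplex_scaleAr (k : R) (x y : C) : k *: (x * y) = x * (k *: y).
Proof. by rewrite mulrC scalerAl mulrC. Qed.
HB.instance Definition _ := GRing.Lalgebra_isAlgebra.Build R C Rcomplex_scaleAr.

Fact Rcomplex_vect_axiom : Vector.axiom 2 C.
Proof.
pose f (z : C) : 'rV[R]_2 := \row_j (if j == 0 then Re z else Im z).
exists f.
  move=> k x y; apply/rowP=> j; rewrite !mxE.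
  by case: x y => a b [c d]; case: eqP.
exists (fun v : 'rV[R]_2 => Complex (v 0 0) (v 0 1) : C) => [[a b]|v].
  by rewrite !mxE.
by apply/rowP=> -[[|[|j]] lj] //; rewrite !mxE /=;
  congr (v 0 _); apply: val_inj.
Qed.
HB.instance Definition _ := Lmodule_hasFinDim.Build R C Rcomplex_vect_axiom.
HB.instance Definition _ := Falgebra.on C.

End ComplexAlg.

Section CycAlg.
Variables (F : fieldType) (n : nat) (e : F).

(* {poly %/ h} is the quotient by h only if h is monic and not constant, which
   holds here for n > 0. *)
Definition cycAlg : Type := {poly %/ ('X^n - e%:P)}.

HB.instance Definition _ := GRing.ComNzRing.copy cycAlg {poly %/ ('X^n - e%:P)}.
HB.instance Definition _ := Vector.copy cycAlg {poly %/ ('X^n - e%:P)}.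
HB.instance Definition _ := GRing.Algebra.copy cycAlg {poly %/ ('X^n - e%:P)}.
HB.instance Definition _ := Algebra_isFalgebra.Build F cycAlg.

Definition cycAlgX : cycAlg := 'qX.

(* When n > 1, the type 'Z_n is the additive group of integers modulo n, and
   the class of 'X has degree its generator 1. *)
Definition cycAlg_comp (k : 'Z_n) : {vspace cycAlg} := <[cycAlgX ^+ k]>%VS.

Hypothesis n_gt1 : (1 < n)%N.

Let mk_monic_cyc : mk_monic ('X^n - e%:P) = 'X^n - e%:P.
Proof.
have n_gt0 := ltnW n_gt1.
by rewrite /mk_monic size_XnsubC // ltnS n_gt0 monicXnsubC.
Qed.

Let size_cyc : size (mk_monic ('X^n - e%:P) : {poly F}) = n.+1.
Proof. by rewrite mk_monic_cyc size_XnsubC // ltnW. Qed.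

Let cycAlgXE m : cycAlgX ^+ m = in_qpoly ('X^n - e%:P) 'X^m.
Proof. by rewrite rmorphXn. Qed.

Lemma cycAlgXn : cycAlgX ^+ n = e *: 1.
Proof.
have: in_qpoly ('X^n - e%:P) ('X^n - e%:P) = 0.
  apply: val_inj; rewrite /= mk_monic_cyc Pdiv.RingMonic.rmodpp //.
  by rewrite monicXnsubC // ltnW.
rewrite linearB /= -cycAlgXE => /eqP; rewrite subr_eq0 => /eqP->.
have -> : in_qpoly ('X^n - e%:P) e%:P = in_qpoly ('X^n - e%:P) (e *: 1).
  by congr in_qpoly; rewrite alg_polyC.
by rewrite linearZ /= rmorph1.
Qed.

Let cycAlgX_mod m : cycAlgX ^+ m = e ^+ (m %/ n) *: cycAlgX ^+ (m %% n).
Proof.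
rewrite {1}(divn_eq m n) exprD mulnC exprM cycAlgXn exprZn expr1n.
by rewrite -scalerAl mul1r.
Qed.

Fact cycAlg_grading : is_grading cycAlg_comp.
Proof.
have En : (Zp_trunc n).+2 = n by rewrite Zp_cast.
have valX (g : 'Z_n) : val (cycAlgX ^+ g : {poly %/ ('X^n - e%:P)}) = 'X^g.
  rewrite cycAlgXE; apply: in_qpoly_small.
  by rewrite size_cyc size_polyXn -[X in (_ < X.+1)%N]En ltnS.
split=> [g h|x|g s gs].
- rewrite prodv_line -memvE -exprD cycAlgX_mod memvZ //=.
  by rewrite -{3}En; exact: memv_line.
- exists (enum 'Z_n).
  have -> : x = \sum_(g <- enum 'Z_n) (x : {poly F})`_g *: cycAlgX ^+ g.
    rewrite big_enum /=; apply: val_inj.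
    rewrite (raddf_sum (val : {poly %/ ('X^n - e%:P)} -> {poly F})) /=.
    under eq_bigr => g _ do rewrite /= valX.
    rewrite -(poly_def (Zp_trunc n).+2 (fun i => (x : {poly F})`_i)) En.
    apply/polyP=> i; rewrite coef_poly; case: ltnP => // ni.
    rewrite nth_default // (leq_trans _ ni) // -ltnS.
    by rewrite (leq_trans (size_mk_monic x)) ?size_cyc.
  by apply: memv_sum_seq => g; rewrite memvZ // memv_line.
apply/eqP; rewrite -subv0; apply/subvP=> x; rewrite memv_cap memv0.
case/andP=> /vlineP[a ->] xs.
suff : (val (a *: cycAlgX ^+ g : {poly %/ ('X^n - e%:P)}))`_g = 0.
  by rewrite /= valX coefZ coefXn eqxx mulr1 => ->; rewrite scale0r.
elim: s gs (a *: _) xs => [_ u|h s IH].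
  by rewrite big_nil memv0 => /eqP->; rewrite coef0.
rewrite inE negb_or big_cons => /andP[gh /IH{}IH] u.
case/memv_addP=> _ /vlineP[b ->] [v /IH v0 ->].
rewrite /= in v0 *; rewrite coefD v0 valX coefZ coefXn.
by rewrite -[(g : nat) == h]/(g == h) (negPf gh) mulr0 addr0.
Qed.

Definition gr_cycAlg : gradedAlg F := GradedAlg cycAlg_grading.

End CycAlg.

(* The tensor product of A and B is realised on the matrices of coordinates
   in the products of the elements of the bases vbasis {:A} and vbasis {:B}. *)
Definition tensor (F : fieldType) (A B : falgType F) : Type :=
  'M[F]_(\dim {:A}, \dim {:B}).

Section Tensor.
Variables (F : fieldType) (A B : falgType F).
Local Notation T := (tensor A B).

HB.instance Definition _ := Vector.copy T 'M[F]_(\dim {:A}, \dim {:B}).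

Definition tens (a : A) (b : B) : T :=
  \matrix_(i, j) (coord (vbasis {:A}) i a * coord (vbasis {:B}) j b).

Fact tens_linearl b : linear (tens^~ b).
Proof.
by move=> k x y; apply/matrixP=> i j; rewrite !mxE linearP mulrDl mulrA.
Qed.

Fact tens_linearr a : linear (tens a).
Proof.
by move=> k x y; apply/matrixP=> i j; rewrite !mxE linearP mulrDr mulrCA.
Qed.

Fact tens0l b : tens 0 b = 0.
Proof. by apply/matrixP=> i j; rewrite !mxE linear0 mul0r. Qed.

HB.instance Definition _ a := GRing.isSemilinear.Build F B T _
  (tens a) (GRing.semilinear_linear (tens_linearr a)).

Let bA (i : 'I_(\dim {:A})) : A := (vbasis {:A})`_i.
Let bB (j : 'I_(\dim {:B})) : B := (vbasis {:B})`_j.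

Let AE a : a = \sum_i coord (vbasis {:A}) i a *: bA i.
Proof. by rewrite {1}(coord_vbasis (memvf a)). Qed.

Let BE b : b = \sum_j coord (vbasis {:B}) j b *: bB j.
Proof. by rewrite {1}(coord_vbasis (memvf b)). Qed.

(* The linear map sending the tensor of a and b to f a b, for f bilinear. *)
Definition tlift (W : lmodType F) (f : A -> B -> W) (M : T) : W :=
  \sum_i \sum_j (M : 'M_(_, _)) i j *: f (bA i) (bB j).

Fact tlift_is_linear (W : lmodType F) (f : A -> B -> W) : linear (tlift f).
Proof.
move=> k M N; rewrite /tlift scaler_sumr -big_split /=; apply: eq_bigr => i _.
rewrite scaler_sumr -big_split /=; apply: eq_bigr => j _.
by rewrite !mxE scalerDl scalerA.
Qed.
HB.instance Definition _ (W : lmodType F) (f : A -> B -> W) :=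
  GRing.isSemilinear.Build F T W _ (tlift f) (GRing.semilinear_linear (tlift_is_linear f)).

Lemma tlift_comb (W : lmodType F) (f g h : A -> B -> W) k M :
  (forall a b, f a b = k *: g a b + h a b) ->
  tlift f M = k *: tlift g M + tlift h M.
Proof.
move=> fE; rewrite /tlift scaler_sumr -big_split /=; apply: eq_bigr => i _.
rewrite scaler_sumr -big_split /=; apply: eq_bigr => j _.
by rewrite fE scalerDr !scalerA mulrC.
Qed.

Lemma tlift_tens (W : lmodType F) (f : A -> B -> W) a b :
  (forall y, linear (f^~ y)) -> (forall x, linear (f x)) ->
  tlift f (tens a b) = f a b.
Proof.
move=> fl fr.
have /= := linear_comb (coord (vbasis {:A})^~ a) bA (fl b); rewrite -AE => ->.
apply: eq_bigr => i _.
have /= := linear_comb (coord (vbasis {:B})^~ b) bB (fr (bA i)).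
rewrite -BE => ->.
rewrite scaler_sumr; apply: eq_bigr => j _.
by rewrite mxE scalerA.
Qed.

Lemma tensor_ind (P : T -> Prop) :
  P 0 -> (forall M N, P M -> P N -> P (M + N)) ->
  (forall a b, P (tens a b)) -> forall M, P M.
Proof.
move=> P0 PD Pt M; rewrite [M]matrix_sum_delta.
apply: (big_ind P) => // i _; apply: (big_ind P) => // j _.
have -> : delta_mx i j = tens (bA i) (bB j).
  apply/matrixP=> k l; rewrite !mxE !coord_free ?(basis_free (vbasisP _)) //.
  by rewrite -natrM mulnb ![_ == k]eq_sym ![_ == l]eq_sym.
by rewrite -[_ *: tens _ _]linearZ; apply: Pt.
Qed.

Lemma tensor_ext (W : lmodType F) (f g : {linear T -> W}) :
  (forall a b, f (tens a b) = g (tens a b)) -> f =1 g.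
Proof.
move=> fg; apply: tensor_ind => // [|M N eM eN]; first by rewrite !linear0.
by rewrite !linearD eM eN.
Qed.

(* The bilinear product given by (a (x) b) (c (x) d) = (a c) (x) (b d). *)
Definition tmul (M N : T) : T :=
  tlift (fun a b => tlift (fun c d => tens (a * c) (b * d)) N) M.

Fact tmul_linearl N : linear (tmul^~ N).
Proof. by move=> k x y; exact: (linearP (tlift _)). Qed.

Fact tmul_linearr M : linear (tmul M).
Proof.
by move=> k x y; apply: tlift_comb => a b; exact: (linearP (tlift _)).
Qed.

Lemma tmul_tens a b c d : tmul (tens a b) (tens c d) = tens (a * c) (b * d).
Proof.
have H x y : tlift (fun c d => tens (x * c) (y * d)) (tens c d)
             = tens (x * c) (y * d).
  apply: tlift_tens => [z|z] k u v.
    by rewrite mulrDr -scalerAr tens_linearl.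
  by rewrite mulrDr -scalerAr tens_linearr.
rewrite /tmul -[RHS]H.
set N := tens c d.
apply: (tlift_tens (f := fun a b => tlift (fun c d => tens (a * c) (b * d)) N))
  => [z|z] k u v.
  by rewrite {}/N !H mulrDl -scalerAl tens_linearl.
by rewrite {}/N !H mulrDl -scalerAl tens_linearr.
Qed.

Fact tmulDl : left_distributive tmul +%R.
Proof. by move=> M N P; have := tmul_linearl P 1 M N; rewrite !scale1r. Qed.

Fact tmulDr : right_distributive tmul +%R.
Proof. by move=> M N P; have := tmul_linearr M 1 N P; rewrite !scale1r. Qed.

Fact tmul0l M : tmul 0 M = 0.
Proof. exact: (linear0 (tlift _)). Qed.

Fact tmul0r M : tmul M 0 = 0.
Proof. by apply: (addrI (tmul M 0)); rewrite -tmulDr !addr0. Qed.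

Fact tmulA : associative tmul.
Proof.
move=> M N P; elim/tensor_ind: M => [|M M' EM EM'|a b].
- by rewrite !tmul0l.
- by rewrite !tmulDl EM EM'.
elim/tensor_ind: N => [|N N' EN EN'|a' b'].
- by rewrite tmul0l !tmul0r tmul0l.
- by rewrite tmulDl !tmulDr EN EN' tmulDl.
elim/tensor_ind: P => [|P P' EP EP'|a'' b''].
- by rewrite !tmul0r.
- by rewrite !tmulDr EP EP'.
by rewrite !tmul_tens !mulrA.
Qed.

Fact tmul1l : left_id (tens 1 1) tmul.
Proof.
elim/tensor_ind => [|M M' EM EM'|a b]; first exact: tmul0r.
  by rewrite tmulDr EM EM'.
by rewrite tmul_tens !mul1r.
Qed.

Fact tmul1r : right_id (tens 1 1) tmul.
Proof.
elim/tensor_ind => [|M M' EM EM'|a b]; first exact: tmul0l.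
  by rewrite tmulDl EM EM'.
by rewrite tmul_tens !mulr1.
Qed.

Fact tone_neq0 : tens 1 1 != 0.
Proof.
apply/eqP=> t0; have /eqP[] := oner_neq0 A; rewrite (AE 1).
apply: big1 => i _; have [->|ci] := eqVneq (coord (vbasis {:A}) i 1) 0.
  by rewrite scale0r.
have /eqP[] := oner_neq0 B; rewrite (BE 1); apply: big1 => j _.
move/matrixP/(_ i j)/eqP: t0; rewrite !mxE mulf_eq0 (negPf ci) /= => /eqP->.
by rewrite scale0r.
Qed.

HB.instance Definition _ :=
  GRing.Zmodule_isNzRing.Build T tmulA tmul1l tmul1r tmulDl tmulDr tone_neq0.

Fact tscaleAl (k : F) (M N : T) : k *: (M * N) = k *: M * N.
Proof. by have := tmul_linearl N k M 0; rewrite tmul0l !addr0. Qed.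

Fact tscaleAr (k : F) (M N : T) : k *: (M * N) = M * (k *: N).
Proof. by have := tmul_linearr M k N 0; rewrite tmul0r !addr0. Qed.

HB.instance Definition _ := GRing.Lmodule_isLalgebra.Build F T tscaleAl.
HB.instance Definition _ := GRing.Lalgebra_isAlgebra.Build F T tscaleAr.
HB.instance Definition _ := Algebra_isFalgebra.Build F T.

Lemma tensM a b c d : tens a b * tens c d = tens (a * c) (b * d).
Proof. exact: tmul_tens. Qed.

Definition tensv (U : {vspace A}) (V : {vspace B}) : {vspace T} :=
  <<[seq tens u v | u <- vbasis U, v <- vbasis V]>>%VS.

Lemma memv_tens (U : {vspace A}) (V : {vspace B}) a b :
  a \in U -> b \in V -> tens a b \in tensv U V.
Proof.
move=> aU bV; rewrite (coord_vbasis aU) (coord_vbasis bV).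
have /= -> := linear_comb (coord (vbasis U)^~ a)
  (fun i => (vbasis U)`_i)
  (tens_linearl (\sum_i coord (vbasis V) i b *: (vbasis V)`_i)).
apply: memv_suml => i _; apply: memvZ.
rewrite linear_sum; apply: memv_suml => j _; rewrite linearZ; apply: memvZ.
by apply/memv_span/allpairs_f; apply: mem_nth; rewrite size_tuple.
Qed.

Lemma subv_tensv (U : {vspace A}) (V : {vspace B}) (W : {vspace T}) :
  (forall a b, a \in U -> b \in V -> tens a b \in W) -> (tensv U V <= W)%VS.
Proof.
move=> UVW; apply/span_subvP=> _ /allpairsP[[u v] /= [uU vV ->]].
by apply: UVW; apply: vbasis_mem.
Qed.

Lemma tensvS U1 U2 V1 V2 :
  (U1 <= U2 -> V1 <= V2 -> tensv U1 V1 <= tensv U2 V2)%VS.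
Proof.
move=> /subvP U12 /subvP V12; apply: subv_tensv => a b aU bV.
by rewrite memv_tens ?U12 ?V12.
Qed.

Lemma prodv_tensv U1 U2 V1 V2 :
  (tensv U1 V1 * tensv U2 V2 <= tensv (U1 * U2) (V1 * V2))%VS.
Proof.
rewrite {1 2}/tensv !span_def big_distrlr /=.
apply: subv_sum_seq => _ /allpairsP[[u v] /= [uU vV ->]].
apply: subv_sum_seq => _ /allpairsP[[u' v'] /= [uU' vV' ->]].
by rewrite prodv_line -memvE tensM memv_tens ?memv_mul ?vbasis_mem.
Qed.

Let tmap (f : 'End(A)) (k : 'End(B)) : T -> T :=
  tlift (fun a b => tens (f a) (k b)).

Let tmap_tens f k a b : tmap f k (tens a b) = tens (f a) (k b).
Proof.
apply: (tlift_tens (f := fun a b => tens (f a) (k b))) => [z|z] c u v.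
  by rewrite linearP tens_linearl.
by rewrite linearP tens_linearr.
Qed.

Variables (G H : zmodType) (c : G -> {vspace A}) (d : H -> {vspace B}).

Definition tensor_comp (p : G * H) : {vspace T} := tensv (c p.1) (d p.2).

Hypotheses (cG : is_grading c) (dG : is_grading d).

Fact tensor_grading : is_grading tensor_comp.
Proof.
case: cG => cM cT cI; case: dG => dM dT dI.
split=> [[g h] [g' h']|x|[g h] s gs].
- apply: subv_trans (prodv_tensv _ _ _ _) _.
  exact: tensvS (cM _ _) (dM _ _).
- elim/tensor_ind: x => [|x y [s xs] [t yt]|a b].
  + by exists [::]; rewrite big_nil mem0v.
  + exists (s ++ t); rewrite big_cat /=; exact: memv_add.
  have [[s sa] [t tb]] := (cT a, dT b).
  exists [seq (g, h) | g <- s, h <- t].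
  suff /subvP : (tensv (\sum_(g <- s) c g) (\sum_(h <- t) d h)
      <= \sum_(p <- [seq (g, h) | g <- s, h <- t]) tensor_comp p)%VS.
    by apply; apply: memv_tens.
  apply: subv_tensv => {sa tb} {}a {}b.
  rewrite !(big_tnth _ _ s) !(big_tnth _ _ t).
  case/memv_sumP=> u uc -> /memv_sumP[v vd ->].
  have -> : tens (\sum_i u i) (\sum_j v j) = \sum_i \sum_j tens (u i) (v j).
    rewrite -(eq_bigr _ (fun i _ => scale1r (u i))).
    have /= -> := linear_comb (fun _ => 1) u (tens_linearl (\sum_j v j)).
    by apply: eq_bigr => i _; rewrite scale1r linear_sum.
  apply: memv_suml => i _; apply: memv_suml => j _.
  have /subvP := @sumv_sup_seq _ _ _ [seq (g, h) | g <- s, h <- t]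
    tensor_comp (tnth (in_tuple s) i, tnth (in_tuple t) j)
    (allpairs_f _ (mem_tnth i (in_tuple s)) (mem_tnth j (in_tuple t))).
  by apply; apply: memv_tens; [apply: uc|apply: vd].
set s1 := [seq k <- unzip1 s | k != g]; set s2 := [seq k <- unzip2 s | k != h].
set U := (\sum_(k <- s1) c k)%VS; set V := (\sum_(k <- s2) d k)%VS.
have cU : (c g :&: U = 0)%VS by apply: cI; rewrite mem_filter eqxx.
have dV : (d h :&: V = 0)%VS by apply: dI; rewrite mem_filter eqxx.
pose f := daddv_pi (c g) U; pose k := daddv_pi (d h) V.
have f0 u : u \in U -> f u = 0.
  move=> uU; have := daddv_pi_add cU (subvP (addvSr (c g) U) _ uU).
  by rewrite -/f daddv_pi_id 1?capvC // -[X in _ = X]add0r => /addIr.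
have k0 v : v \in V -> k v = 0.
  move=> vV; have := daddv_pi_add dV (subvP (addvSr (d h) V) _ vV).
  by rewrite -/k daddv_pi_id 1?capvC // -[X in _ = X]add0r => /addIr.
pose Phi := linfun (tmap f k).
apply/eqP; rewrite -subv0; apply/subvP=> x; rewrite memv_cap => /andP[xg xs].
have /subvP/(_ _ xg) : (tensor_comp (g, h) <= fixedSpace Phi)%VS.
  apply: subv_tensv => a b /= ac bd; apply/fixedSpaceP.
  by rewrite lfunE [LHS]tmap_tens !daddv_pi_id.
have /subvP/(_ _ xs) : (\sum_(p <- s) tensor_comp p <= lker Phi)%VS.
  apply: subv_sum_seq => -[g' h'] ps; apply: subv_tensv => a b /= ac bd.
  rewrite memv_ker lfunE [X in X == _]tmap_tens.
  have [eg|ng] := eqVneq g' g; last first.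
    rewrite f0 ?tens0l //.
    apply: (subvP (sumv_sup_seq _ _) _ ac).
    by rewrite mem_filter ng (map_f fst ps).
  have nh : h' != h by apply: contraNneq gs => <-; rewrite -eg.
  rewrite k0 ?linear0 //; apply: (subvP (sumv_sup_seq _ _) _ bd).
  by rewrite mem_filter nh (map_f snd ps).
rewrite memv_ker => /eqP P0 /fixedSpaceP; rewrite P0 => <-.
exact: mem0v.
Qed.

End Tensor.

Definition gr_tensor (F : fieldType) (A B : gradedAlg F) : gradedAlg F :=
  GradedAlg (tensor_grading (gr_axiom A) (gr_axiom B)).

Inductive gda_class : Type :=
| RealGroupAlg (G : finZmodType)
| ComplexGroupAlg (G : finZmodType)
| TwistedGroupAlg (m : nat) (m_gt0 : (0 < m)%N) (G : finZmodType).

Lemma expn2_gt1 m : (0 < m)%N -> (1 < 2 ^ m)%N.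
Proof. by move=> m_gt0; rewrite -{1}(expn0 2) ltn_exp2l. Qed.

Definition class_alg (R : realType) (p : gda_class) : gradedAlg R :=
  match p with
  | RealGroupAlg G => gr_groupAlg R^o G
  | ComplexGroupAlg G => gr_groupAlg (Rcomplex R) G
  | TwistedGroupAlg m m_gt0 G =>
      gr_tensor (gr_cycAlg (-1 : R) (expn2_gt1 m_gt0)) (gr_groupAlg R^o G)
  end.

Definition same_class (p q : gda_class) : Prop :=
  match p, q with
  | RealGroupAlg G, RealGroupAlg H => group_iso G H
  | ComplexGroupAlg G, ComplexGroupAlg H => group_iso G H
  | TwistedGroupAlg m _ G, TwistedGroupAlg k _ H => m = k /\ group_iso G H
  | _, _ => False
  end.

(* Main.v *)
Require Import Defs.
From HB Require Import structures.
From mathcomp Require Import all_boot all_order all_algebra all_field.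
From mathcomp Require Import fingroup cyclic.
From mathcomp Require Import boolp reals complex.

(** Let A be a commutative graded division algebra over R, with grading
    group T.  Directness of the grading makes T finite, and the identity
    component A_0 is a field of finite dimension over R: it is R or C
    (gr0_real_or_complex).  Every other component is A_0 u for a unit u.

    Since T is finite, there is M > 1 such that M T = 0 and such that every
    component contains an element u with u ^+ M = 1.  The pairs (g, u) with u in A_g and u ^+ M = 1
    form an abelian group E (root_group), an extension of T by the group of
    M-th roots of unity of A_0.  The algebra A can be recovered from this
    extension, so everything is about splitting it.

    The tool is a cheap form of injectivity of Z/N over itself: if x in E is
    such that k x is in N E only when N divides k, then some homomorphism from
    E to Z/N sends x to 1 (retract_cyclic).  Its kernel G and the multiples
    of x then generate E.

    If A_0 = C, take for x a primitive M-th root of unity in A_0, with N = M: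
    the kernel is mapped isomorphically onto T, so the extension splits, and A
    is the complex group algebra of G (split_extension).

    If A_0 = R, the kernel of E -> T has order 2 and is generated by z = -1.
    Let m be the largest integer such that z = 2^m x for some x in E, and
    choose such an x.  By maximality of m, it satisfies the above condition for
    N = 2^(m+1) (max_height).  If m = 0 then x = z, the extension
    splits, and A is the real group algebra of G.  If m > 0, then T is the sum
    of the cyclic group of order 2^m generated by the degree of x and of the
    image of G, and A is the tensor product of the subalgebra generated by x,
    where x ^+ 2 ^ m = -1, and of the real group algebra of G
    (split_double_cover).

    For uniqueness, record for which g and j the component A_g contains a
    2^j-th root of -1 (gr_root).  This occurs for g = 0 and j = 1 only in the
    complex case; otherwise the largest j is 0 for the real group algebras and
    m for the twisted ones.  The group G is then determined by T: this is
    immediate for group algebras, and for twisted ones it is the cancellation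
    of Z/2^m from a direct sum, which holds because Z/2^m is a local ring
    (cancel_Zp2). *)

Set Implicit Arguments.
Unset Strict Implicit.
Unset Printing Implicit Defensive.
Import GRing.Theory.
Local Open Scope ring_scope.

(** * Additive maps and finite abelian groups *)

Lemma additive_inverse (G H : zmodType) (f : {additive G -> H}) :
  bijective f -> exists2 g : {additive H -> G}, cancel f g & cancel g f.
Proof.
case=> g fK gK; have gB : zmod_morphism g.
  by move=> x y; apply: (can_inj fK); rewrite raddfB !gK.
pose g_add := GRing.isZmodMorphism.Build _ _ g gB.
by exists (HB.pack g g_add : {additive H -> G}).
Qed.

Lemma group_iso_sym (G H : zmodType) : group_iso G H -> group_iso H G.
Proof.
by case=> f /additive_inverse[g fK gK]; exists g; exists f.
Qed.

Lemma group_iso_trans (G H K : zmodType) :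
  group_iso G H -> group_iso H K -> group_iso G K.
Proof. by move=> [f fb] [g gb]; exists (g \o f); apply: bij_comp. Qed.

Lemma bij_of_inj_surj (X Y : Type) (f : X -> Y) :
  injective f -> (forall y, exists x, f x = y) -> bijective f.
Proof.
move=> f_inj f_surj.
have gP y : {x | f x = y} by apply: cid.
exists (fun y => sval (gP y)) => [x|y]; last exact: svalP (gP y).
exact: f_inj (svalP (gP (f x))).
Qed.

Lemma raddf_ker0_inj (G H : zmodType) (f : {additive G -> H}) :
  (forall x, f x = 0 -> x = 0) -> injective f.
Proof.
move=> f0 x y /eqP; rewrite -subr_eq0 -raddfB => /eqP/f0/eqP.
by rewrite subr_eq0 => /eqP.
Qed.

Lemma mulrn_mod (V : zmodType) (t : V) n k :
  t *+ n = 0 -> t *+ (k %% n) = t *+ k.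
Proof.
move=> tn; rewrite [in RHS](divn_eq k n) mulrnDr mulnC mulrnA tn.
by rewrite mul0rn add0r.
Qed.

Lemma Zp_pairE n (G : zmodType) (x : 'Z_n) (h : G) :
  (x, h) = (1, 0) *+ x + (0, h) :> 'Z_n * G.
Proof.
have -> k : (1, 0) *+ k = (k%:R, 0) :> 'Z_n * G.
  elim: k => // k IH; rewrite mulrS IH.
  by congr (_, _); rewrite ?addr0 // -natr1 addrC.
by congr (_, _); rewrite /= ?add0r // natr_Zp addr0.
Qed.

(** A copy of T that carries the finite type structure given by an enumeration
    of its elements; the proof is an argument so that the instances below can
    find it. *)
Definition enumZmod (T : zmodType) (s : seq T) of (forall x, x \in s) : Type :=
  T.

Section EnumZmod.
Variables (T : zmodType) (s : seq T) (sT : forall x, x \in s).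
Local Notation S := (enumZmod sT).

HB.instance Definition _ := GRing.Zmodule.copy S T.

Fact enumZmod_pickleK :
  pcancel (fun x : S => index (x : T) s)
          (fun n => if (n < size s)%N then Some (nth 0 s n : S) else None).
Proof. by move=> x; rewrite index_mem sT nth_index. Qed.

HB.instance Definition _ := Choice_isCountable.Build S enumZmod_pickleK.

Fact enumZmod_axiom : Finite.axiom (undup s : seq S).
Proof.
apply: Finite.uniq_enumP; first exact: undup_uniq.
by move=> x; rewrite [LHS]mem_undup sT.
Qed.

HB.instance Definition _ := isFinite.Build S enumZmod_axiom.

End EnumZmod.

Lemma finite_zmod (T : zmodType) (s : seq T) : (forall x, x \in s) ->
  exists (G : finZmodType) (f : {additive G -> T}), bijective f.
Proof.
move=> sT; exists (enumZmod sT : finZmodType).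
exists (idfun : {additive enumZmod sT -> enumZmod sT}).
by exists id.
Qed.

Lemma finite_zmod_torsion (T : zmodType) (s : seq T) : (forall x, x \in s) ->
  exists2 K, (0 < K)%N & forall x : T, x *+ K = 0.
Proof.
move=> /finite_zmod[G [f [g fK gK]]]; exists #|G|.
  by apply/card_gt0P; exists 0.
move=> x; rewrite -(gK x) -raddfMn.
suff -> : g x *+ #|G| = 0 by rewrite raddf0.
rewrite -FinRing.zmodXgE -cardsT.
exact: (@cyclic.expg_cardG _ [set: G]%G (g x) (in_setT _)).
Qed.

Section Kernel.
Variables (E V : zmodType) (f : {additive E -> V}).

Definition ker_pred : {pred E} := fun y => f y == 0.

Fact ker_pred_closed : zmod_closed ker_pred.
Proof.
split=> [|x y /eqP fx /eqP fy]; first by rewrite /ker_pred unfold_in raddf0.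
by rewrite unfold_in /ker_pred raddfB fx fy subr0.
Qed.
HB.instance Definition _ := GRing.isZmodClosed.Build E ker_pred ker_pred_closed.

Record kernel := Kernel { kernel_val : E; _ : kernel_val \in ker_pred }.
HB.instance Definition _ := [isSub for kernel_val].
HB.instance Definition _ := [Choice of kernel by <:].
HB.instance Definition _ := [SubChoice_isSubZmodule of kernel by <:].

(** The kernel is delivered as a finZmodType G with an embedding i, which is
    the form in which the model algebras take their groups. *)
Lemma finite_kernel (s : seq E) : (forall y, y \in s) ->
  exists (G : finZmodType) (i : {additive G -> E}),
    injective i /\ forall y, f y = 0 <-> exists g, i g = y.
Proof.
move=> sE.
have sK (y : kernel) : y \in pmap insub s by rewrite mem_pmap_sub sE.
have [G [j jbij]] := finite_zmod sK.
exists G, ((val : {additive kernel -> E}) \o j); split.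
  exact: inj_comp val_inj (bij_inj jbij).
move=> y; split=> [/eqP fy|[g <-]]; last exact/eqP/(valP (j g)).
case: jbij => k jK kK; exists (k (Kernel fy)).
by rewrite /= kK.
Qed.

End Kernel.

(** * Retractions onto cyclic groups *)

Lemma subrB_swap (V : zmodType) (a b c d : V) :
  a - b - (c - d) = a - c - (b - d).
Proof. by rewrite !opprD !opprK addrACA. Qed.

Lemma natr_Zp_eq0 (N k : nat) : (1 < N)%N -> (k%:R == 0 :> 'Z_N) = (N %| k)%N.
Proof.
by move=> N_gt1; rewrite -(inj_eq val_inj) /= val_Zp_nat // /dvdn.
Qed.

Lemma intr_Zp_eq0 (N : nat) (k : int) :
  (1 < N)%N -> (k%:~R == 0 :> 'Z_N) = (N %| `|k|)%N.
Proof.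
move=> N1; rewrite [in LHS](intEsign k) rmorphM /= rmorph_sign mulr_sign.
by case: ifP => _; rewrite ?oppr_eq0 natr_Zp_eq0.
Qed.

(** In Z/N, the elements killed by N/n are the multiples of n. *)
Lemma Zp_divisible (N n : nat) (v : 'Z_N) : (1 < N)%N -> (n %| N)%N ->
  v *+ (N %/ n) = 0 -> exists d : 'Z_N, v = d *+ n.
Proof.
move=> N1 nN v0.
have q_gt0 : (0 < N %/ n)%N.
  have N0 := ltnW N1; by rewrite divn_gt0 ?(dvdn_gt0 N0 nN) // dvdn_leq.
have : (n %| v)%N.
  rewrite -(dvdn_pmul2l q_gt0) divnK // mulnC -natr_Zp_eq0 //.
  by rewrite natrM natr_Zp mulr_natr v0.
case/dvdnP=> d vE; exists d%:R.
by rewrite -[v]natr_Zp vE mulrnA.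
Qed.

(** A homomorphism from a subgroup of E to Z/N is represented by its graph P, so
    that extending it amounts to enlarging P.  Vanishing on N E is what makes
    such homomorphisms extendable. *)
Record partial_retract (E : zmodType) (N : nat) (x : E)
    (P : E -> 'Z_N -> Prop) : Prop := PartialRetract {
  partialB : forall e d e' d', P e d -> P e' d' -> P (e - e') (d - d');
  partial0 : forall d, P 0 d -> d = 0;
  partial_gen : P x 1;
  partialMn : forall y, P (y *+ N) 0 }.

Section PartialRetract.
Variables (E : zmodType) (N : nat) (x : E) (P : E -> 'Z_N -> Prop).
Hypotheses (N_gt1 : (1 < N)%N) (PP : partial_retract x P).

Lemma partial_zero : P 0 0.
Proof. by have := partialMn PP 0; rewrite mul0rn. Qed.

Lemma partialN e d : P e d -> P (- e) (- d).
Proof. by move=> /(partialB PP partial_zero); rewrite !sub0r. Qed.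

Lemma partialD e d e' d' : P e d -> P e' d' -> P (e + e') (d + d').
Proof. by move=> Ped /partialN/(partialB PP Ped); rewrite !opprK. Qed.

Lemma partialMz e d (k : int) : P e d -> P (e *~ k) (d *~ k).
Proof.
move=> Ped; elim/int_ind: k => [|n IH|n IH].
- by rewrite !mulr0z; apply: partial_zero.
- by rewrite !intS !mulrzDr !mulr1z; apply: partialD.
rewrite !intS !opprD !mulrzDr !mulrN1z; apply: partialD => //.
exact: partialN.
Qed.

(** Let n y be the least positive multiple of y in the domain of P, with value
    v.  As N y is in the domain with value 0, n divides N and (N/n) v = 0, so
    that v = n d for some d; then y can be mapped to d. *)
Lemma partial_extend y : exists2 Q : E -> 'Z_N -> Prop,
  partial_retract x Q & (forall e d, P e d -> Q e d) /\ exists d, Q y d.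
Proof.
have exn : exists n, (0 < n)%N && `[< exists v, P (y *+ n) v >].
  exists N; rewrite ltnW //=; apply/asboolP; exists 0; exact: (partialMn PP).
case: (ex_minnP exn) => n /andP[n_gt0 /asboolP[v Pnv]] n_min.
have dvd_n k w : P (y *~ k) w -> (n %| k)%Z.
  move=> Pk; rewrite (divz_eq k n) rpredD ?dvdz_mull //.
  have : P (y *~ (k %% n)%Z) (w - v *~ (k %/ n)%Z).
    rewrite {1}/modz mulrzBr mulrC mulrzA; apply: (partialB PP) => //.
    exact: partialMz.
  have : (0 <= (k %% n)%Z) by rewrite modz_ge0 // eqz_nat -lt0n.
  have : ((k %% n)%Z < n)%R by rewrite ltz_pmod.
  case: (k %% n)%Z => // r; rewrite ltz_nat => rn _ Pr.
  have [->|r_gt0] := posnP r; first exact: dvdz0.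
  suff : (n <= r)%N by rewrite leqNgt rn.
  by apply: n_min; rewrite r_gt0; apply/asboolP; eexists; exact: Pr.
have nN : (n %| N)%N by apply: (dvd_n N 0); apply: (partialMn PP).
have [d vE] : exists d : 'Z_N, v = d *+ n.
  apply: Zp_divisible => //; apply: (partial0 PP).
  have := partialMz (N %/ n)%N Pnv; rewrite -2!pmulrn -mulrnA mulnC divnK //.
  move=> /(partialB PP (partialMn PP y)); rewrite subrr sub0r.
  by move=> /partialN; rewrite oppr0 opprK.
(* The graph of the map that sends e + k y to w + k d, for (e, w) in P. *)
exists (fun e w => exists k : int, P (e - y *~ k) (w - d *~ k)).
  split=> [e w e' w' [k Pk] [k' Pk']|w [k]||z].
  - exists (k - k'); rewrite !mulrzBr.
    by rewrite subrB_swap [X in P _ X]subrB_swap; apply: (partialB PP).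
  - rewrite sub0r -mulrNz => Pk; have := dvd_n _ _ Pk.
    case/dvdzP=> q kE; move: Pk; rewrite kE mulrC mulrzA.
    move=> /(partialB PP (partialMz q Pnv)); rewrite subrr.
    move=> /(partial0 PP)/eqP; rewrite subr_eq0 vE.
    rewrite -[k]opprK kE mulrNz opprK -subr_eq => /eqP <-.
    by rewrite mulrC mulrzA subrr.
  - by exists 0; rewrite !subr0; apply: (partial_gen PP).
  - by exists 0; rewrite !subr0; apply: (partialMn PP).
split=> [e w Pew|]; first by exists 0; rewrite !subr0.
by exists d, 1; rewrite !subrr; apply: partial_zero.
Qed.

End PartialRetract.

(** The hypothesis on x says that x has order N in E / N E, so that mapping x
    to 1 and N E to 0 is consistent; this map is then extended to one element
    of E after the other. *)
Lemma retract_cyclic (E : zmodType) (s : seq E) (N : nat) (x : E) :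
    (forall y, y \in s) -> (1 < N)%N ->
    (forall k y, x *+ k = y *+ N -> (N %| k)%N) ->
  exists chi : {additive E -> 'Z_N}, chi x = 1.
Proof.
move=> sE N_gt1 xN.
have xNz (k : int) y : x *~ k = y *+ N -> (N %| `|k|)%N.
  case: k => n; first exact: xN.
  rewrite NegzE mulrNz => /(canRL opprK); rewrite -mulNrn; exact: xN.
pose P0 (e : E) (d : 'Z_N) :=
  exists (k : int) (y : E), e = x *~ k + y *+ N /\ d = k%:~R.
have PP0 : partial_retract x P0.
  split=> [e d e' d' [k [y [-> ->]]] [k' [y' [-> ->]]]|d [k [y [e0 ->]]]||y].
  - exists (k - k'), (y - y'); split; last by rewrite rmorphB.
    by rewrite mulrzBr mulrnBl opprD addrACA.
  - apply/eqP; rewrite intr_Zp_eq0 //.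
    by apply: (xNz k (- y)); rewrite mulNrn; apply/eqP; rewrite -addr_eq0 -e0.
  - by exists 1, 0; rewrite mul0rn addr0.
  - by exists 0, y; rewrite mulr0z add0r.
have [P PP sP] : exists2 P : E -> 'Z_N -> Prop,
    partial_retract x P & forall e, e \in s -> exists d, P e d.
  elim: {sE} s => [|y s [P PP IH]]; first by exists P0.
  have [Q QQ [PQ Qy]] := partial_extend N_gt1 PP y.
  exists Q => // e; rewrite inE => /predU1P[->//|/IH[d Ped]].
  by exists d; apply: PQ.
pose chi e : 'Z_N := projT1 (cid (sP e (sE e))).
have chiP e : P e (chi e) by rewrite /chi; case: cid.
have chi_eq e d : P e d -> chi e = d.
  move=> Ped; apply/eqP; rewrite -subr_eq0; apply/eqP/(partial0 PP).
  by rewrite -(subrr e); apply: (partialB PP).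
have chiB : zmod_morphism chi.
  by move=> e e'; apply: chi_eq; apply: (partialB PP).
pose chi_add := GRing.isZmodMorphism.Build _ _ chi chiB.
pose chiA : {additive E -> 'Z_N} := HB.pack chi chi_add.
by exists chiA; apply/chi_eq/(partial_gen PP).
Qed.

(** * Splitting extensions of finite abelian groups *)

Section Extension.
Variables (E T : zmodType) (deg : {additive E -> T}) (s : seq T).
Hypotheses (sT : forall t, t \in s) (deg_onto : forall t, exists e, deg e = t).
Variables (N : nat) (z : E).
Hypotheses (N_gt1 : (1 < N)%N) (zN : z *+ N = 0).
Hypothesis deg_ker : forall e, deg e = 0 <-> exists k, e = z *+ k.

Lemma finite_extension : exists s' : seq E, forall e, e \in s'.
Proof.
have rP t : {e | deg e = t} by apply: cid.
exists [seq sval (rP t) + z *+ k | t <- s, k <- iota 0 N] => e.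
apply/allpairsP.
have /deg_ker[k ek] : deg (e - sval (rP (deg e))) = 0.
  by rewrite raddfB (svalP (rP _)) subrr.
exists (deg e, k %% N)%N; split=> //=.
  by rewrite mem_iota leq0n add0n ltn_mod ltnW.
by rewrite mulrn_mod // -ek addrC subrK.
Qed.

(** A homomorphism that maps z to 1 has a kernel G that meets the multiples of
    z in 0 and that, together with them, generates E. *)
Lemma split_extension : (forall k y, z *+ k = y *+ N -> (N %| k)%N) ->
  exists (G : finZmodType) (i : {additive G -> E}), bijective (deg \o i).
Proof.
move=> zP; have [s' s'E] := finite_extension.
have [chi chi_z] := retract_cyclic s'E N_gt1 zP.
have [G [i [i_inj iP]]] := finite_kernel chi s'E.
exists G, i; apply: bij_of_inj_surj.
  apply: (raddf_ker0_inj (f := deg \o i)) => g /= /deg_ker[k igk].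
  apply: i_inj; rewrite raddf0 igk.
  have /eqP : chi (i g) = 0 by apply/iP; exists g.
  rewrite igk raddfMn chi_z natr_Zp_eq0 // => /dvdnP[q ->].
  by rewrite mulnC mulrnA zN mul0rn.
move=> t; have [e <-] := deg_onto t.
have /iP[g gE] : chi (e - z *+ chi e) = 0.
  by rewrite raddfB raddfMn chi_z natr_Zp subrr.
exists g; rewrite /= gE raddfB.
have -> : deg (z *+ chi e) = 0 by apply/deg_ker; exists (chi e).
by rewrite subr0.
Qed.

End Extension.

Section DoubleCover.
Variables (E T : zmodType) (deg : {additive E -> T}) (s : seq T).
Hypotheses (sT : forall t, t \in s) (deg_onto : forall t, exists e, deg e = t).
Variable (z : E).
Hypotheses (z_neq0 : z != 0) (z2 : z *+ 2 = 0).
Hypothesis deg_ker : forall e, deg e = 0 <-> exists k, e = z *+ k.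

(** Take m maximal such that z = 2^m x has a solution.  If k x = 2^(m+1) y with
    k = 2^a q, q odd and a <= m, then multiplying by 2^(m-a) yields
    z = q z = 2^(m+1) (2^(m-a) y), against the choice of m. *)
Lemma max_height : exists m x, x *+ 2 ^ m = z /\
  forall k y, x *+ k = y *+ 2 ^ m.+1 -> (2 ^ m.+1 %| k)%N.
Proof.
have [s' s'E] := finite_extension sT deg_onto (isT : 1 < 2)%N z2 deg_ker.
have [M M_gt0 ME] := finite_zmod_torsion s'E.
have z_odd q : odd q -> z *+ q = z.
  by move=> q_odd; rewrite -(mulrn_mod _ z2) modn2 q_odd.
pose P m := `[< exists x : E, x *+ 2 ^ m = z >].
have exP : exists m, P m by exists 0%N; apply/asboolP; exists z.
(* If m exceeds the 2-adic valuation of M, where M = 2^a q kills E, then M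
   divides q 2^m, so that q 2^m x = 0, while q 2^m x = q z = z. *)
have P_bound m : P m -> (m <= logn 2 M)%N.
  move=> /asboolP[x xz]; rewrite leqNgt; apply: contra z_neq0 => Mm.
  have [q + ME2] := pfactor_coprime (isT : prime 2) M_gt0.
  rewrite coprime2n => q_odd; rewrite -(z_odd q q_odd) -xz -mulrnA mulnC.
  by rewrite -(subnKC (ltnW Mm)) expnD mulnA -ME2 mulrnA ME mul0rn.
case: (ex_maxnP exP P_bound) => m /asboolP[x xz] m_max.
exists m, x; split=> // k y xky; apply: contraT => k_ndvd.
have k_gt0 : (0 < k)%N by case: k k_ndvd {xky} => //; rewrite dvdn0.
have [q + kE] := pfactor_coprime (isT : prime 2) k_gt0.
rewrite coprime2n => q_odd.
have am : (logn 2 k <= m)%N by rewrite leqNgt -pfactor_dvdn.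
have /m_max : P m.+1.
  apply/asboolP; exists (y *+ 2 ^ (m - logn 2 k)).
  rewrite mulrnAC -xky {1}kE -[RHS](z_odd q) // -xz -!mulrnA.
  by rewrite -mulnA -expnD subnKC // mulnC.
by rewrite ltnn.
Qed.

(** With x as in max_height and chi a retraction mapping x to 1 in
    Z/2^(m+1), G is the kernel of chi.  The element z = 2^m x has degree 0,
    hence the degree of x generates a group of order 2^m only. *)
Lemma split_double_cover :
  (exists (G : finZmodType) (i : {additive G -> E}), bijective (deg \o i)) \/
  exists m (x : E) (G : finZmodType) (i : {additive G -> E})
    (alpha : {additive 'Z_(2 ^ m) * G -> T}),
    [/\ (0 < m)%N, x *+ 2 ^ m = z, bijective alpha
      & forall p, alpha p = deg x *+ p.1 + deg (i p.2)].
Proof.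
have [[|m] [x [xz xP]]] := max_height.
  (* Here x = z. *)
  left; apply: (split_extension sT deg_onto (N := 2) (z := z)) => //.
  by rewrite -xz mulr1n.
right; set n := (2 ^ m.+1)%N; set N := (2 ^ m.+2)%N.
have N_gt1 : (1 < N)%N by apply: expn2_gt1.
have n_gt1 : (1 < n)%N by apply: expn2_gt1.
have Nn : N = (2 * n)%N by rewrite /N expnS.
have [s' s'E] := finite_extension sT deg_onto (isT : 1 < 2)%N z2 deg_ker.
have [chi chi_x] := retract_cyclic s'E N_gt1 xP.
have [G [i [i_inj iP]]] := finite_kernel chi s'E.
have deg_z : deg z = 0 by apply/deg_ker; exists 1%N.
have deg_xn : deg x *+ n = 0 by rewrite -raddfMn xz deg_z.
pose alpha (p : 'Z_n * G) := deg x *+ p.1 + deg (i p.2).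
have alpha_add : nmod_morphism alpha.
  split=> [|[a g] [b h]]; rewrite /alpha /= ?mulr0n ?raddf0 ?addr0 //.
  rewrite [X in (_ %% X)%N]Zp_cast // mulrn_mod // mulrnDr !raddfD.
  by rewrite addrACA.
pose alpha_a := GRing.isNmodMorphism.Build _ _ alpha alpha_add.
exists m.+1, x, G, i, (HB.pack alpha alpha_a : {additive 'Z_n * G -> T}).
split=> //; apply: bij_of_inj_surj.
  apply: raddf_ker0_inj => -[a g] /=; rewrite /alpha /=.
  rewrite -raddfMn -raddfD => /deg_ker[k xk].
  have chi_i : chi (i g) = 0 by apply/iP; exists g.
  have a_lt : (a < n)%N by rewrite -[X in (_ < X)%N](Zp_cast n_gt1).
  (* If a deg x + deg (i g) = 0, then a x + i g = k z = k n x; applying chi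
     shows that a = k n modulo N, hence that a = 0 modulo n. *)
  have chi_z : chi z = n%:R by rewrite -xz raddfMn chi_x.
  have /(congr1 val) : (a : nat)%:R = (n * k)%:R :> 'Z_N.
    rewrite natrM mulr_natr -chi_z -raddfMn -xk raddfD raddfMn chi_x chi_i.
    by rewrite addr0.
  rewrite /= !val_Zp_nat // => /(congr1 (modn^~ n)).
  rewrite !modn_dvdm ?Nn ?dvdn_mull // modnMr modn_small // => a0.
  have ig : i g = z *+ k by rewrite -xk a0 add0r.
  have : (n * k)%:R == 0 :> 'Z_N.
    by rewrite natrM mulr_natr -chi_z -raddfMn -ig chi_i.
  rewrite natr_Zp_eq0 // Nn mulnC dvdn_pmul2l ?(ltnW n_gt1) // => /dvdnP[q kq].
  congr (_, _); first exact: val_inj.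
  by apply: i_inj; rewrite raddf0 ig kq mulnC mulrnA z2 mul0rn.
move=> t; have [e <-] := deg_onto t.
have /iP[g gE] : chi (e - x *+ chi e) = 0.
  by rewrite raddfB raddfMn chi_x natr_Zp subrr.
exists ((chi e : nat)%:R, g); rewrite /= /alpha /= gE raddfB raddfMn.
by rewrite val_Zp_nat // mulrn_mod // addrC subrK.
Qed.

End DoubleCover.

(** * Cancellation of a cyclic 2-group *)

Section Cancellation.
Variables (n : nat) (G H : zmodType).
Local Notation C := 'Z_n.

Lemma iso_fstE (f : {additive C * G -> C * H}) x h :
  (f (x, h)).1 = (f (1, 0)).1 * x + (f (0, h)).1.
Proof.
rewrite Zp_pairE raddfD raddfMn /=; congr (_ + _).
rewrite -{2}[x]natr_Zp mulr_natr.
by elim: (x : nat) => // k IH; rewrite !mulrS /= IH.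
Qed.

(** Write f as a matrix with rows a, b and c, d, where a is an endomorphism of
    Z/n, that is, the multiplication by a scalar.  If a is invertible, then the
    Schur complement d - c a^-1 b is an isomorphism from G to H. *)
Lemma cancel_unit (f : {additive C * G -> C * H}) :
  bijective f -> (f (1, 0)).1 \is a GRing.unit -> group_iso G H.
Proof.
set a := (f (1, 0)).1 => -[g fK gK] ua.
pose s h : C := - (a^-1 * (f (0, h)).1).
have f_s h : (f (s h, h)).1 = 0.
  by rewrite iso_fstE -/a /s mulrN mulrA mulrV // mul1r addNr.
have sB : {morph s : h k / h - k}.
  move=> h k; rewrite /s -[X in (X, _)](subrr 0).
  rewrite -[(_ - _, _)]/((0, h) - (0, k)).
  by rewrite raddfB /= mulrBr opprD.
pose phi h := (f (s h, h)).2.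
have phiB : zmod_morphism phi.
  move=> h k; rewrite /phi sB -[(_ - _, _)]/((s h, h) - (s k, k)).
  by rewrite raddfB.
pose phi_add := GRing.isZmodMorphism.Build _ _ phi phiB.
pose phiA : {additive G -> H} := HB.pack phi phi_add.
exists phiA; exists (fun k => (g (0, k)).2) => [h|k] /=.
  have -> : (0, phi h) = f (s h, h).
    by rewrite /phi -(f_s h) -surjective_pairing.
  by rewrite fK.
have := gK (0, k); case: (g (0, k)) => x h /= fxh.
suff sh : s h = x by rewrite /phi sh fxh.
have /eqP := congr1 fst fxh; rewrite /= iso_fstE -/a addrC addr_eq0 => /eqP fh.
by rewrite /s fh mulrN opprK mulrA mulVr // mul1r.
Qed.

End Cancellation.

Lemma odd_ZpE m (x : 'Z_(2 ^ m)) :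
  (0 < m)%N -> (x \is a GRing.unit) = odd x.
Proof.
move=> m_gt0; rewrite -[x in LHS]natr_Zp unitZpE ?expn2_gt1 //.
by rewrite coprime_pexpl // coprime2n.
Qed.

Lemma odd_ZpD m (x y : 'Z_(2 ^ m)) :
  (0 < m)%N -> odd (x + y)%R = odd x (+) odd y.
Proof.
move=> m_gt0; rewrite /= [X in (_ %% X)%N]Zp_cast ?expn2_gt1 //.
by rewrite odd_mod ?oddD // oddX orbF -leqn0 leqNgt m_gt0.
Qed.

(** If the corner a of the matrix of f is not a unit, let a', c' be the first
    column of the inverse matrix, so that a a' + b c' = 1.  As Z/2^m is a local
    ring, b c' is a unit and a + b c' is one too; the latter is the corner of
    the composite of f with the automorphism (x, h) |-> (x, h + c' x). *)
Lemma cancel_Zp2 m (G H : zmodType) : (0 < m)%N ->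
  group_iso ('Z_(2 ^ m) * G)%type ('Z_(2 ^ m) * H)%type -> group_iso G H.
Proof.
move=> m_gt0 [f fbij].
have [ua|nua] := boolP ((f (1, 0)).1 \is a GRing.unit).
  exact: cancel_unit fbij ua.
have [g fK gK] := fbij.
pose c (x : 'Z_(2 ^ m)) := (g (x, 0)).2.
have gB : {morph g : p q / p - q}.
  by move=> p q; apply: (can_inj fK); rewrite raddfB !gK.
have cB : {morph c : x y / x - y}.
  move=> x y; rewrite /c -[X in (_, X)](subrr 0).
  by rewrite -[(_ - _, _)]/((x, 0) - (y, 0)) gB.
pose sig (p : 'Z_(2 ^ m) * G) := (p.1, p.2 + c p.1).
have sigB : zmod_morphism sig.
  move=> p q; rewrite /sig; congr (_, _) => /=.
  by rewrite cB opprD addrACA.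
have sig_bij : bijective sig.
  exists (fun p => (p.1, p.2 - c p.1)) => -[x h] /=; congr (_, _) => /=.
    by rewrite addrK.
  by rewrite subrK.
pose sig_add := GRing.isZmodMorphism.Build _ _ sig sigB.
pose sigA : {additive 'Z_(2 ^ m) * G -> 'Z_(2 ^ m) * G} := HB.pack sig sig_add.
apply: (@cancel_unit _ _ _ (f \o sigA)) => /=; first exact: bij_comp.
rewrite /sig /= add0r iso_fstE // mulr1 odd_ZpE // odd_ZpD //.
rewrite -odd_ZpE // (negPf nua) addFb.
have : f ((g (1, 0)).1, c 1) = (1, 0) by rewrite -surjective_pairing gK.
move/(congr1 fst); rewrite /= iso_fstE // => fc.
have : odd (1%R : 'Z_(2 ^ m)) by rewrite -odd_ZpE // unitr1.
by rewrite -{1}fc odd_ZpD // -odd_ZpE // unitrM (negPf nua).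
Qed.

(** * Graded algebras *)

Section GradedAlgebra.
Variables (F : fieldType) (A : gradedAlg F).
Local Notation T := (gr_group A).
Local Notation c := (@gr_comp F A).

Lemma grM (g h : T) x y : x \in c g -> y \in c h -> x * y \in c (g + h).
Proof.
case: (gr_axiom A) => cM _ _ xg yh.
by apply: (subvP (cM g h)); apply: memv_mul.
Qed.

Lemma gr_sum0 (s : seq T) (u : T -> A) :
    uniq s -> (forall g, g \in s -> u g \in c g) -> \sum_(g <- s) u g = 0 ->
  forall g, g \in s -> u g = 0.
Proof.
case: (gr_axiom A) => _ _ cI.
elim: s => // h s IH /= /andP[hs s_uniq] uc; rewrite big_cons => u0.
have uh : u h = 0.
  apply/eqP; rewrite -memv0 -(cI h s hs) memv_cap uc ?mem_head //=.
  move/eqP: u0; rewrite addr_eq0 => /eqP->; rewrite rpredN.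
  rewrite big_seq; apply: rpred_sum => g gs.
  by apply: (subvP (sumv_sup_seq _ gs)); rewrite uc // inE gs orbT.
move=> g; rewrite inE => /predU1P[->//|]; apply: IH => // [k ks|].
  by rewrite uc // inE ks orbT.
by move: u0; rewrite uh add0r.
Qed.

Lemma gr_decomp (x : A) : exists (s : seq T) (u : T -> A),
  [/\ uniq s, forall g, g \in s -> u g \in c g & x = \sum_(g <- s) u g].
Proof.
case: (gr_axiom A) => _ /(_ x)[s xs] _.
have {xs} : x \in (\sum_(g <- undup s) c g)%VS.
  by apply: (subvP _ _ xs); apply: subv_sum_seq => g gs;
     apply: sumv_sup_seq; rewrite mem_undup.
rewrite (big_nth 0) big_mkord => /memv_sumP[u uc ->].
(* memv_sumP indexes the summands by positions; index them by degrees. *)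
exists (undup s), (fun g =>
  \sum_(i < size (undup s) | nth 0 (undup s) i == g) u i).
split=> [|g gs|]; first exact: undup_uniq.
  by apply: rpred_sum => i /eqP <-; apply: uc.
rewrite (big_nth 0) big_mkord; apply: eq_bigr => i _.
rewrite (bigD1 i) //= big1 ?addr0 // => j /andP[/eqP ij] /eqP[].
by apply/val_inj/eqP; rewrite /= -(nth_uniq 0 _ _ (undup_uniq s)) // ij.
Qed.

Hypothesis cn0 : forall g, c g != 0%VS.

(** A basis of A lies in the sum of finitely many components; directness leaves
    no room for other nonzero ones. *)
Lemma gr_support_finite : exists s : seq T, forall g, g \in s.
Proof.
case: (gr_axiom A) => _ cT cI.
have spanX (X : seq A) : exists s : seq T, (<<X>> <= \sum_(g <- s) c g)%VS.
  elim: X => [|x X [s Xs]]; first by exists [::]; rewrite span_nil sub0v.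
  have [t xt] := cT x; exists (t ++ s).
  by rewrite span_cons big_cat addvS // -memvE.
have [s sP] := spanX (vbasis {:A}); exists s => g.
apply: contraNT (cn0 g) => /cI gs; rewrite -gs; apply/eqP/esym/capv_idPl.
by apply: subv_trans (subvf _) _; rewrite -(span_basis (vbasisP {:A})).
Qed.

End GradedAlgebra.
Arguments gr_sum0 {F A s u}.

(** Equivalences will be constructed from the model algebra B to A: it is enough
    that phi maps each component bijectively onto the corresponding one. *)
Lemma gr_equiv_inverse (F : fieldType) (A B : gradedAlg F)
    (phi : {lrmorphism B -> A}) (alpha : {additive gr_group B -> gr_group A}) :
    bijective alpha ->
    (forall g x, x \in gr_comp g -> phi x \in gr_comp (alpha g)) ->
    (forall g y, y \in gr_comp (alpha g) ->
       exists2 x, x \in gr_comp g & y = phi x) ->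
    (forall g x, x \in gr_comp g -> phi x = 0 -> x = 0) ->
  gr_equiv A B.
Proof.
move=> alpha_bij phi_comp phi_onto phi_inj.
have [beta alphaK betaK] := additive_inverse alpha_bij.
pose f : 'Hom(B, A) := linfun phi.
have fE x : f x = phi x by rewrite lfunE.
have f_inj : lker f == 0%VS.
  rewrite -subv0; apply/subvP=> x; rewrite memv_ker memv0 fE => /eqP.
  have [s [u [s_uniq us ->]]] := gr_decomp x; rewrite rmorph_sum => fx0.
  rewrite big_seq big1 // => g gs; apply: (phi_inj g _ (us g gs)).
  have su := @gr_sum0 _ A (map alpha s) (fun h => phi (u (beta h))).
  rewrite -(alphaK g); apply: su; last exact: map_f.
  - by rewrite map_inj_uniq //; apply: bij_inj.
  - by move=> h /mapP[k ks ->]; rewrite alphaK phi_comp // us.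
  - by rewrite big_map -[RHS]fx0; apply: eq_bigr => k _; rewrite alphaK.
have f_onto : limg f = {:A}%VS.
  apply/eqP; rewrite eqEsubv subvf /=; apply/subvP=> y _.
  have [s [u [s_uniq us ->]]] := gr_decomp y.
  rewrite big_seq; apply: rpred_sum => g gs.
  have [|x _ ->] := phi_onto (beta g) (u g); first by rewrite betaK us.
  by rewrite -fE memv_img ?memvf.
have fVK y : f ((f^-1)%VF y) = y by apply: limg_lfunVK; rewrite f_onto memvf.
have fK x : (f^-1)%VF (f x) = x by apply: lker0_lfunK.
have fVM : ahom_in {:A} (f^-1)%VF.
  apply/ahom_inP; split=> [x y _ _|].
    have fM z t : f (z * t) = f z * f t by rewrite !fE rmorphM.
    by rewrite -[in LHS](fVK x) -[in LHS](fVK y) -fM fK.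
  have f1 : f 1 = 1 by rewrite fE rmorph1.
  by rewrite -f1 fK.
exists (AHom fVM), beta; split=> /=; first by exists f.
  by exists alpha.
move=> g; apply/eqP; rewrite eqEsubv; apply/andP; split.
  apply/subvP=> _ /memv_imgP[y yg ->].
  have [|x xg ->] := phi_onto (beta g) y; first by rewrite betaK.
  by rewrite -fE fK.
apply/subvP=> x xg; rewrite -(fK x) memv_img // fE -[g]betaK.
exact: phi_comp.
Qed.

Section GradedDivision.
Variables (F : fieldType) (A : gradedAlg F).
Hypothesis Adiv : graded_division A.
Local Notation T := (gr_group A).
Local Notation c := (@gr_comp F A).

Lemma gr_unit (g : T) x : x \in c g -> x != 0 -> x \is a GRing.unit.
Proof. by case: Adiv => + _; apply. Qed.

Lemma gr_neq0 (g : T) : exists2 x, x \in c g & x != 0.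
Proof.
case: Adiv => _ /(_ g) cg; exists (vpick (c g)); first exact: memv_pick.
by rewrite vpick0.
Qed.

(** The multiplication by x is injective on the finite-dimensional space A_0,
    hence onto. *)
Lemma gr0_divisible x y : x \in c 0 -> x != 0 -> y \in c 0 ->
  exists2 z, z \in c 0 & y = x * z.
Proof.
move=> x0 xn0 y0; have ux := gr_unit x0 xn0.
have sub : (amull x @: c 0 <= c 0)%VS.
  apply/subvP=> _ /memv_imgP[z z0 ->].
  by rewrite lfunE /= -(addr0 (0 : T)) grM.
have /eqP im : (amull x @: c 0)%VS == c 0.
  rewrite eqEdim sub limg_dim_eq //=.
  apply/eqP; rewrite eqEsubv sub0v andbT; apply/subvP=> z.
  rewrite memv_cap memv_ker => /andP[_].
  by rewrite lfunE /= mulrI_eq0 ?memv0 //; apply: mulrI.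
move: y0; rewrite -{1}im => /memv_imgP[z z0 ->]; exists z => //.
by rewrite lfunE.
Qed.

(** A nonzero x in A_0 is x z for some z in A_0, and then z = 1. *)
Lemma gr1 : 1 \in c 0.
Proof.
have [x x0 xn0] := gr_neq0 0.
have [z z0 xz] := gr0_divisible x0 xn0 x0.
suff -> : 1 = z by [].
by apply: (mulrI (gr_unit x0 xn0)); rewrite mulr1.
Qed.

Lemma grX (g : T) x k : x \in c g -> x ^+ k \in c (g *+ k).
Proof.
move=> xg; elim: k => [|k IH]; first exact: gr1.
by rewrite exprS mulrS grM.
Qed.

(** The inverse is obtained as y z, with y in the component of - g and z an
    inverse in A_0 of x y. *)
Lemma grV (g : T) x : x \in c g -> x != 0 -> x^-1 \in c (- g).
Proof.
move=> xg xn0; have ux := gr_unit xg xn0.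
have [y yg yn0] := gr_neq0 (- g); have uy := gr_unit yg yn0.
have xy0 : x * y \in c 0 by rewrite -(subrr g) grM.
have uxy : x * y \is a GRing.unit by rewrite unitrMl.
have [|z z0 xyz] := gr0_divisible xy0 _ gr1.
  by apply: contraTneq uxy => ->; rewrite unitr0.
suff -> : x^-1 = y * z by rewrite -(addr0 (- g)) grM.
by apply: (mulrI ux); rewrite mulrV // mulrA.
Qed.

Lemma gr_ratio (g : T) x y : x \in c g -> x != 0 -> y \in c g ->
  exists2 a, a \in c 0 & y = a * x.
Proof.
move=> xg xn0 yg; exists (y * x^-1); last by rewrite divrK // (gr_unit xg).
by rewrite -(subrr g) grM // grV.
Qed.

End GradedDivision.

(** * Equivalences with the model algebras *)

Lemma lrmorphism_intro (F : fieldType) (A B : falgType F) (f : A -> B) :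
    linear f -> {morph f : x y / x * y} -> f 1 = 1 ->
  exists phi : {lrmorphism A -> B}, phi =1 f.
Proof.
move=> f_lin fM f1.
pose f_l := GRing.isLinear.Build F A B _ f f_lin.
pose f_m := GRing.isMonoidMorphism.Build A B f (conj f1 fM).
by exists (HB.pack f f_l f_m : {lrmorphism A -> B}).
Qed.

Section Lifts.
Variables (F : fieldType) (A : falgType F).
Hypothesis Acomm : forall x y : A, x * y = y * x.

Lemma groupAlg_lift (K : falgType F) (G : finZmodType)
    (iota : {lrmorphism K -> A}) (u : G -> A) :
    (forall g h, u (g + h) = u g * u h) -> u 0 = 1 ->
  exists phi : {lrmorphism groupAlg K G -> A},
    forall g a, phi (gsingle g a) = iota a * u g.
Proof.
move=> uM u0; pose f (v : groupAlg K G) := \sum_g iota (v g) * u g.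
have f_lin : linear f.
  move=> k v w; rewrite /f scaler_sumr -big_split; apply: eq_bigr => g _ /=.
  by rewrite !ffunE linearP mulrDl scalerAl.
have f_single g a : f (gsingle g a) = iota a * u g.
  rewrite /f (bigD1 g) //= big1 ?addr0 ?ffunE ?eqxx // => h hg.
  by rewrite ffunE (negPf hg) raddf0 mul0r.
have [||phi phiE] := @lrmorphism_intro _ _ _ f f_lin.
- move=> v w; rewrite /f mulr_suml.
  under [RHS]eq_bigr => g _ do rewrite mulr_sumr.
  transitivity (\sum_k \sum_g iota (v g * w (k - g)) * u k).
    by apply: eq_bigr => k _; rewrite ffunE raddf_sum mulr_suml.
  rewrite exchange_big; apply: eq_bigr => g _ /=.
  rewrite (reindex_inj (addrI g)) /=; apply: eq_bigr => h _.
  rewrite [g + h]addrC addrK addrC uM rmorphM -!mulrA; congr (_ * _).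
  by rewrite mulrA [iota _ * u g]Acomm mulrA.
- by rewrite f_single rmorph1 mul1r.
by exists phi => g a; rewrite phiE f_single.
Qed.

Lemma tensor_lift (B C : falgType F)
    (phi : {lrmorphism B -> A}) (psi : {lrmorphism C -> A}) :
  exists chi : {lrmorphism tensor B C -> A},
    forall b c, chi (tens b c) = phi b * psi c.
Proof.
pose f : tensor B C -> A := tlift (fun b c => phi b * psi c).
have f_tens b c : f (tens b c) = phi b * psi c.
  apply: (tlift_tens (f := fun b c => phi b * psi c)) => z k x y.
    by rewrite linearP mulrDl scalerAl.
  by rewrite linearP mulrDr scalerAr.
have f0 : f 0 = 0 by rewrite /f linear0.
have fD M N : f (M + N) = f M + f N by rewrite /f linearD.
have fM M N : f (tmul M N) = f M * f N.
  elim/tensor_ind: M => [|M M' EM EM'|b c].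
  - by rewrite tmul0l f0 mul0r.
  - by rewrite tmulDl !fD EM EM' mulrDl.
  elim/tensor_ind: N => [|N N' EN EN'|b' c'].
  - by rewrite tmul0r f0 mulr0.
  - by rewrite tmulDr !fD EN EN' mulrDr.
  rewrite tmul_tens !f_tens !rmorphM -!mulrA; congr (_ * _).
  by rewrite mulrA [phi b' * psi c]Acomm -mulrA.
have [||chi chiE] := @lrmorphism_intro _ _ _ f (tlift_is_linear _).
- exact: fM.
- by rewrite [1]/(tens 1 1) f_tens !rmorph1 mulr1.
by exists chi => b c; rewrite chiE f_tens.
Qed.

(** The evaluation at x kills X^n - e, hence factors through the quotient. *)
Lemma cycAlg_lift n (e : F) (x : A) : (1 < n)%N -> x ^+ n = e%:A ->
  exists phi : {lrmorphism cycAlg n e -> A}, phi (cycAlgX n e) = x.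
Proof.
move=> n_gt1 xn; have n_gt0 := ltnW n_gt1.
pose h : {poly F} := 'X^n - e%:P.
have hE : mk_monic h = h.
  by rewrite /mk_monic size_XnsubC // ltnS n_gt0 monicXnsubC.
have h0 : horner_alg x h = 0.
  by rewrite rmorphB rmorphXn /= horner_algX horner_algC xn subrr.
have modE p : horner_alg x (Pdiv.Ring.rmodp p h) = horner_alg x p.
  have hm : h \is monic by rewrite monicXnsubC.
  rewrite [p in RHS](Pdiv.RingMonic.rdivp_eq hm) rmorphD rmorphM /=.
  by rewrite h0 mulr0 add0r.
pose f (q : cycAlg n e) := horner_alg x (val (q : {poly %/ h})).
have [|||phi phiE] := @lrmorphism_intro _ _ _ f.
- move=> k p q; rewrite /f.
  have -> : val (k *: p + q : {poly %/ h}) =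
      k *: val (p : {poly %/ h}) + val (q : {poly %/ h}) by [].
  by rewrite linearP /= mulr_algl.
- move=> p q; rewrite /f.
  have -> : val (p * q : {poly %/ h}) =
      Pdiv.Ring.rmodp (val (p : {poly %/ h}) * val (q : {poly %/ h})) h.
    by rewrite -[X in Pdiv.Ring.rmodp _ X]hE.
  by rewrite modE rmorphM.
- by rewrite /f rmorph1.
exists phi; rewrite phiE /f.
have -> : val (cycAlgX n e : {poly %/ h}) = Pdiv.Ring.rmodp 'X h.
  by rewrite -[X in Pdiv.Ring.rmodp _ X]hE.
by rewrite modE horner_algX.
Qed.

End Lifts.

Section Equivalences.
Variables (F : fieldType) (A : gradedAlg F).
Hypotheses (Adiv : graded_division A) (Acomm : forall x y : A, x * y = y * x).
Local Notation T := (gr_group A).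
Local Notation c := (@gr_comp F A).

(** Choosing a generator of each component over A_0 identifies A with K G as a
    graded vector space; the products agree because the choice is
    multiplicative. *)
Lemma equiv_groupAlg (K : falgType F) (iota : {lrmorphism K -> A})
    (G : finZmodType) (alpha : {additive G -> T}) (u : G -> A) :
    injective iota -> (forall a, iota a \in c 0) ->
    (forall y, y \in c 0 -> exists a, y = iota a) ->
    bijective alpha -> (forall g, u g \in c (alpha g)) ->
    (forall g, u g \is a GRing.unit) -> {morph u : g h / g + h >-> g * h} ->
  gr_equiv A (gr_groupAlg K G).
Proof.
move=> iota_inj iota0 iota_onto alpha_bij ua u_unit uM.
have u0 : u 0 = 1 by apply: (mulrI (u_unit 0)); rewrite -uM addr0 mulr1.
have [phi phiE] := groupAlg_lift Acomm iota uM u0.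
apply: (gr_equiv_inverse
  (phi := (phi : {lrmorphism gr_groupAlg K G -> A})) alpha_bij).
- move=> g _ /groupAlg_compP[a ->] /=.
  by rewrite phiE -[alpha g]add0r grM.
- move=> g y yg /=; have [|b b0 ->] := gr_ratio Adiv (ua g) _ yg.
    by apply: contraTneq (u_unit g) => ->; rewrite unitr0.
  have [a ->] := iota_onto b b0; exists (gsingle g a); last by rewrite phiE.
  by apply/groupAlg_compP; exists a.
move=> g _ /groupAlg_compP[a ->] /=; rewrite phiE.
move/(congr1 (fun x => x / u g)).
rewrite mulrK // mul0r => ia0.
by have -> : a = 0; [apply: iota_inj; rewrite raddf0 | rewrite linear0].
Qed.

Lemma scalar_lrmorphism : exists iota : {lrmorphism F^o -> A},
  forall a, iota a = a%:A.
Proof.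
have [|||iota iotaE] := @lrmorphism_intro F F^o A (fun a => a%:A).
- by move=> k a b; rewrite scalerDl scalerA.
- by move=> a b; rewrite -scalerAl mul1r scalerA.
- by rewrite scale1r.
by exists iota.
Qed.

Lemma tensZl (B C : falgType F) k (b : B) (d : C) :
  tens (k *: b) d = k *: tens b d.
Proof. by have := tens_linearl d k b 0; rewrite tens0l !addr0. Qed.

Lemma tensv_line (B C : falgType F) (b : B) (d : C) x :
  x \in tensv <[b]>%VS <[d]>%VS -> exists k, x = k *: tens b d.
Proof.
move=> xin; apply/vlineP; apply: (subvP _ _ xin); apply: subv_tensv.
move=> _ _ /vlineP[k ->] /vlineP[l ->].
by rewrite linearZ /= tensZl !memvZ // memv_line.
Qed.

Lemma groupAlg_comp_line (G : finZmodType) (g : G) :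
  @groupAlg_comp F F^o G g = <[gsingle g (1%R : F^o)]>%VS.
Proof.
apply/vspaceP=> x; apply/groupAlg_compP/vlineP => -[a ->]; exists a.
  by rewrite -[a in LHS]mulr1 -linearZ.
by rewrite -linearZ /= [a *: _]mulr1.
Qed.

(** Each component of the tensor product is the line spanned by the tensor of
    X^k and of g; it is mapped to the line spanned by x ^+ k * u g. *)
Lemma equiv_twisted n (n_gt1 : (1 < n)%N) (e : F) (x : A) (G : finZmodType)
    (alpha : {additive 'Z_n * G -> T}) (u : G -> A) :
    (forall y, y \in c 0 -> exists k : F, y = k%:A) ->
    bijective alpha -> x \in c (alpha (1, 0)) -> x \is a GRing.unit ->
    x ^+ n = e%:A -> (forall g, u g \in c (alpha (0, g))) ->
    (forall g, u g \is a GRing.unit) -> {morph u : g h / g + h >-> g * h} ->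
  gr_equiv A (gr_tensor (gr_cycAlg e n_gt1) (gr_groupAlg F^o G)).
Proof.
move=> c0 alpha_bij xa x_unit xn ua u_unit uM.
have u0 : u 0 = 1 by apply: (mulrI (u_unit 0)); rewrite -uM addr0 mulr1.
have [iota iotaE] := scalar_lrmorphism.
have [psi psiE] := groupAlg_lift Acomm iota uM u0.
have [phi phiX] := cycAlg_lift n_gt1 xn.
have [chi chiE] := tensor_lift Acomm phi psi.
pose w (k : nat) (g : G) := tens (cycAlgX n e ^+ k) (gsingle g (1 : F^o)).
have chi_w k g : chi (w k g) = x ^+ k * u g.
  by rewrite chiE rmorphXn /= psiE phiX iotaE scale1r mul1r.
have compE (k : 'Z_n) g y : y \in tensor_comp (@cycAlg_comp F n e)
    (@groupAlg_comp F F^o G) (k, g) -> exists l, y = l *: w k g.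
  by rewrite /tensor_comp /= groupAlg_comp_line; apply: tensv_line.
have w_comp (k : 'Z_n) g : x ^+ k * u g \in c (alpha (k, g)).
  by rewrite Zp_pairE raddfD raddfMn grM // (grX Adiv).
have w_unit (k : nat) g : x ^+ k * u g \is a GRing.unit.
  by rewrite unitrMl // unitrX.
pose B := gr_tensor (gr_cycAlg e n_gt1) (gr_groupAlg F^o G).
apply: (gr_equiv_inverse (B := B)
  (phi := (chi : {lrmorphism B -> A})) alpha_bij).
- move=> [k g] _ /compE[l ->] /=.
  by rewrite linearZ /= chi_w memvZ.
- move=> [k g] y yg /=; have [|b b0 ->] := gr_ratio Adiv (w_comp k g) _ yg.
    by apply: contraTneq (w_unit k g) => ->; rewrite unitr0.
  have [l ->] := c0 b b0; exists (l *: w k g).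
    apply: memvZ; apply: memv_tens; first exact: memv_line.
    by apply/groupAlg_compP; exists 1.
  by rewrite linearZ /= chi_w -scalerAl mul1r.
move=> [k g] _ /compE[l ->] /=; rewrite linearZ /= chi_w => /eqP.
rewrite scaler_eq0 => /orP[/eqP->|/eqP w0]; first by rewrite scale0r.
by have := w_unit k g; rewrite w0 unitr0.
Qed.

End Equivalences.

(** * The group of homogeneous roots of unity *)

Section RootGroup.
Variables (F : fieldType) (A : gradedAlg F).
Hypotheses (Adiv : graded_division A) (Acomm : forall x y : A, x * y = y * x).
Local Notation T := (gr_group A).
Local Notation c := (@gr_comp F A).
Variable M : nat.
Hypothesis M_gt0 : (0 < M)%N.

Definition root_pred (p : T * A) := (p.2 \in c p.1) && (p.2 ^+ M == 1).
Local Notation E := {p : T * A | root_pred p}.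

Fact root_add_subproof (p q : E) :
  root_pred ((val p).1 + (val q).1, (val p).2 * (val q).2).
Proof.
case: p q => -[g x] /andP[/= xg xM] [[h y] /andP[/= yh yM]].
by rewrite /root_pred /= grM //= exprMn_comm ?(eqP xM) ?(eqP yM) ?mulr1.
Qed.

Fact root_opp_subproof (p : E) : root_pred (- (val p).1, (val p).2^-1).
Proof.
case: p => -[g x] /andP[/= xg xM].
have xn0 : x != 0.
  by apply: contraTneq xM => ->; rewrite expr0n gtn_eqF // eq_sym oner_eq0.
by rewrite /root_pred /= (grV Adiv) //= exprVn (eqP xM) invr1.
Qed.

Fact root_zero_subproof : root_pred (0, 1).
Proof. by rewrite /root_pred /= (gr1 Adiv) expr1n eqxx. Qed.

Let add (p q : E) : E := Sub _ (root_add_subproof p q).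
Let opp (p : E) : E := Sub _ (root_opp_subproof p).
Let zero : E := Sub _ root_zero_subproof.

Record is_root_group (Z : zmodType) (deg : {additive Z -> T}) (v : Z -> A) :
    Prop := IsRootGroup {
  root_deg : forall e, v e \in c (deg e);
  root_expM : forall e, v e ^+ M = 1;
  rootD : {morph v : e f / e + f >-> e * f};
  root_inj : forall e f, deg e = deg f -> v e = v f -> e = f;
  root_onto : forall g y, y \in c g -> y ^+ M = 1 ->
    exists2 e, deg e = g & v e = y }.

(** The pairs (g, y) with y in A_g and y ^+ M = 1, with deg and v as the two
    projections.  Keeping the degree in the pair makes it a homomorphism. *)
Lemma root_group : exists (Z : zmodType) (deg : {additive Z -> T}) (v : Z -> A),
  is_root_group deg v.
Proof.
have addA : associative add.
  by move=> p q r; apply: val_inj; rewrite /= addrA mulrA.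
have addC : commutative add.
  by move=> p q; apply: val_inj; rewrite /= addrC Acomm.
have add0 : left_id zero add.
  by case=> -[g x] p; apply: val_inj; rewrite /= add0r mul1r.
have addN : left_inverse zero opp add.
  case=> -[g x] p; apply: val_inj; rewrite /= addNr mulVr //.
  case/andP: p => /= xg xM; apply: (gr_unit Adiv xg).
  by apply: contraTneq xM => ->; rewrite expr0n gtn_eqF // eq_sym oner_eq0.
pose mix := GRing.isZmodule.Build E addA addC add0 addN.
pose Z : zmodType := HB.pack E mix.
pose deg (e : Z) := (val (e : E)).1.
have deg_add : nmod_morphism deg by split.
pose deg_a := GRing.isNmodMorphism.Build Z T deg deg_add.
exists Z, (HB.pack deg deg_a : {additive Z -> T}), (fun e => (val (e : E)).2).
split=> //.
- by move=> e; case/andP: (valP (e : E)).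
- by move=> e; case/andP: (valP (e : E)) => _ /eqP.
- move=> [[g x] p] [[h y] q] /= gh xy; apply: val_inj; congr (_, _) => //.
move=> g y yg /eqP yM.
have p : root_pred (g, y) by rewrite /root_pred yg.
by exists (Sub (g, y) p).
Qed.

Section RootGroupTheory.
Variables (Z : zmodType) (deg : {additive Z -> T}) (v : Z -> A).
Hypothesis ZP : is_root_group deg v.

Lemma root_unit e : v e \is a GRing.unit.
Proof. by rewrite -(unitrX_pos _ M_gt0) (root_expM ZP) unitr1. Qed.

Lemma root0 : v 0 = 1.
Proof.
by apply: (mulrI (root_unit 0)); rewrite -(rootD ZP) addr0 mulr1.
Qed.

Lemma rootMn e k : v (e *+ k) = v e ^+ k.
Proof.
elim: k => [|k IH]; first exact: root0.
by rewrite mulrS exprS (rootD ZP) IH.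
Qed.

(** The kernel of deg is the group of M-th roots of unity of A_0, so it is cyclic
    when that group is. *)
Lemma root_ker z : deg z = 0 ->
    (forall y, y \in c 0 -> y ^+ M = 1 -> exists k, y = v z ^+ k) ->
  forall e, deg e = 0 <-> exists k, e = z *+ k.
Proof.
move=> z0 zP e; split=> [e0|[k ->]]; last by rewrite raddfMn z0 mul0rn.
have [||k vk] := zP (v e); first by rewrite -e0 (root_deg ZP).
  exact: root_expM ZP e.
exists k; apply: (root_inj ZP); first by rewrite raddfMn z0 mul0rn.
by rewrite vk rootMn.
Qed.

End RootGroupTheory.

End RootGroup.

(** * The identity component *)

(** The evaluation at y cannot be injective on the polynomials of degree at most
    the dimension of A. *)
Lemma falg_annihilator (F : fieldType) (A : falgType F) (y : A) :
  exists2 P : {poly F}, P != 0 & horner_alg y P = 0.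
Proof.
set n := (\dim {:A}).+1.
pose h (p : {poly_n F}) := horner_alg y p.
have h_lin : linear h by move=> k p q; rewrite /h linearP /= mulr_algl.
pose h_l := GRing.isLinear.Build F {poly_n F} A _ h h_lin.
pose f : 'Hom({poly_n F}, A) :=
  linfun (HB.pack h h_l : {linear {poly_n F} -> A}).
have fE p : f p = horner_alg y p by rewrite /f lfunE.
have ker_f : lker f != 0%VS.
  apply/eqP=> f0; have := limg_ker_dim f fullv.
  rewrite capfv f0 dimv0 add0n dim_polyn => dim_f.
  by have := dimvS (subvf (limg f)); rewrite dim_f ltnn.
exists (vpick (lker f) : {poly_n F}); last first.
  by rewrite -fE; apply/eqP; rewrite -memv_ker memv_pick.
by rewrite -vpick0 in ker_f.
Qed.

Section RealSquares.
Variable R : rcfType.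
Local Notation rc := (real_complex R).

(** The monic real polynomial with roots z and its conjugate. *)
Definition conj_quad (z : R[i]) : {poly R} :=
  ('X - (complex.Re z)%:P) ^+ 2 + (complex.Im z ^+ 2)%:P.

Lemma map_conj_quad (z : R[i]) :
  map_poly rc (conj_quad z) = ('X - z%:P) * ('X - (conjc z)%:P).
Proof.
rewrite /conj_quad rmorphD rmorphXn rmorphB /= map_polyX !map_polyC /=.
set a := ((complex.Re z)%:C%C)%:P; set b := ((complex.Im z)%:C%C)%:P.
set i := ('i%C : R[i])%:P.
have i2 : i * i = -1 by rewrite -polyCM -[_ * _]expr2 sqr_i polyCN.
have -> : z%:P = a + i * b by rewrite -polyCM -polyCD -complexE.
have -> : (conjc z)%:P = a - i * b.
  rewrite -polyCM -polyCN -polyCD; congr _%:P.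
  by rewrite [z in LHS]complexE; simpc.
have -> : ((complex.Im z ^+ 2)%:C%C)%:P = b ^+ 2 by rewrite rmorphXn polyC_exp.
have -> : 'X - (a + i * b) = 'X - a - i * b by rewrite opprD addrA.
have -> : 'X - (a - i * b) = 'X - a + i * b by rewrite opprB addrA addrAC.
by rewrite -subr_sqr exprMn [i ^+ 2]i2 mulN1r opprK.
Qed.

(** Over C, P equals its conjugate; multiplying the factorizations of both pairs
    the factors of z and of its conjugate.  Taking the square of P avoids the
    distinction between real and nonreal roots. *)
Lemma sqr_prod_conj_quad (P : {poly R}) : P != 0 ->
  exists (k : R) (s : seq R[i]),
    k != 0 /\ P ^+ 2 = k *: \prod_(z <- s) conj_quad z.
Proof.
move=> P0; pose Q := map_poly rc P.
have [s Qs] := closed_field_poly_normal Q.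
have lQ : lead_coef Q = rc (lead_coef P) by rewrite lead_coef_map.
have conjQ : map_poly (conjc (R := R)) Q = Q.
  by rewrite -map_poly_comp; apply: eq_map_poly => x; apply: conjc_real.
exists (lead_coef P ^+ 2), s; split.
  by rewrite expf_neq0 // lead_coef_eq0.
apply: (map_poly_inj rc); rewrite rmorphXn /= -/Q.
rewrite map_polyZ rmorph_prod expr2 -{2}conjQ Qs.
rewrite map_polyZ rmorph_prod /= lQ conjc_real -scalerAl -scalerAr scalerA.
rewrite -expr2 -rmorphXn -big_split; congr (_ *: _); apply: eq_bigr => z _.
by rewrite map_conj_quad rmorphB /= map_polyX map_polyC.
Qed.

End RealSquares.

Section IdentityComponent.
Variables (R : rcfType) (A : gradedAlg R).
Hypotheses (Adiv : graded_division A) (Acomm : forall x y : A, x * y = y * x).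
Local Notation c := (@gr_comp R A).

Lemma gr0_alg (k : R) : k%:A \in c 0.
Proof. by rewrite memvZ // (gr1 Adiv). Qed.

Lemma gr0_mul x y : x \in c 0 -> y \in c 0 -> x * y \in c 0.
Proof. by move=> x0 y0; rewrite -(addr0 (0 : gr_group A)) grM. Qed.

Lemma gr0_mul_eq0 x y : x \in c 0 -> y \in c 0 -> x * y = 0 -> x = 0 \/ y = 0.
Proof.
move=> x0 y0 xy; have [->|xn0] := eqVneq x 0; [by left | right].
by apply: (mulrI (gr_unit Adiv x0 xn0)); rewrite mulr0.
Qed.

(** A product of quadratic factors annihilates y, and A_0 is a domain. *)
Lemma gr0_quadratic y : y \in c 0 ->
  exists a b : R, (y - a%:A) ^+ 2 + (b ^+ 2)%:A = 0.
Proof.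
move=> y0; have [P Pn0 Py] := falg_annihilator y.
have [k [s [kn0 PE]]] := sqr_prod_conj_quad Pn0.
pose q (z : R[i]) := horner_alg y (conj_quad z).
have qE z : q z = (y - (complex.Re z)%:A) ^+ 2 + (complex.Im z ^+ 2)%:A.
  by rewrite /q rmorphD rmorphXn rmorphB /= horner_algX !horner_algC.
have q0 z : q z \in c 0.
  by rewrite qE rpredD ?gr0_alg // expr2 gr0_mul // rpredB // gr0_alg.
have prod0 : \prod_(z <- s) q z = 0.
  have := congr1 (horner_alg y) PE.
  rewrite rmorphXn /= Py expr0n linearZ /= mulr_algl rmorph_prod => /esym/eqP.
  by rewrite scaler_eq0 (negPf kn0) => /eqP.
elim: s {PE} prod0 => [|z s IH].
  by rewrite big_nil => /eqP; rewrite oner_eq0.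
rewrite big_cons => /gr0_mul_eq0[//||qz|//].
  elim: (s) => [|w t tc]; rewrite ?big_nil ?big_cons ?(gr1 Adiv) //.
  exact: gr0_mul.
by exists (complex.Re z), (complex.Im z); rewrite -qE.
Qed.

(** Every y in A_0 satisfies (y - a)^2 + b^2 = 0 with a, b real.  If A_0 contains
    a square root J of -1, this factors into y = a + b J or y = a - b J.
    Otherwise b = 0, as (y - a) / b would be such a root, and y = a. *)
Lemma gr0_real_or_complex :
  (forall y, y \in c 0 -> exists k : R, y = k%:A) \/
  exists iota : {lrmorphism Rcomplex R -> A},
    [/\ injective iota, forall a, iota a \in c 0
      & forall y, y \in c 0 -> exists a, y = iota a].
Proof.
have [[J [J0 J2]]|noJ] := pselect (exists J, J \in c 0 /\ J ^+ 2 = - 1).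
  right.
  pose f (z : Rcomplex R) := (complex.Re z)%:A + complex.Im z *: J.
  have [|||iota iotaE] := @lrmorphism_intro R (Rcomplex R) A f.
  - move=> k [a b] [a' b']; rewrite /f /= !scalerDl -!scalerA scalerDr.
    by rewrite addrACA.
  - move=> [a b] [a' b']; rewrite /f /= mulrDl !mulrDr -!scalerAl -!scalerAr.
    rewrite !mul1r !mulr1 !scalerA -[J * J]expr2 J2 scalerN scalerBl scalerDl.
    by rewrite [_ *: J - _]addrC [RHS]addrACA.
  - by rewrite /f /= scale0r addr0 scale1r.
  exists iota; split; first exact: fmorph_inj.
    by move=> z; rewrite iotaE rpredD ?gr0_alg // memvZ.
  move=> y y0; have [a [b ab]] := gr0_quadratic y0.
  have ya0 : y - a%:A \in c 0 by rewrite rpredB ?gr0_alg.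
  have bJ0 : b *: J \in c 0 by rewrite memvZ.
  have : (y - a%:A - b *: J) * (y - a%:A + b *: J) = 0.
    have sqrB (u v : A) : (u - v) * (u + v) = u ^+ 2 - v ^+ 2.
      by rewrite mulrBl !mulrDr [v * u]Acomm opprD addrA addrK !expr2.
    by rewrite sqrB exprZn J2 scalerN opprK.
  case/gr0_mul_eq0 => [||/eqP|/eqP].
  - exact: rpredB.
  - exact: rpredD.
  - rewrite subr_eq0 subr_eq addrC => /eqP->.
    by exists (Complex a b); rewrite iotaE.
  rewrite addr_eq0 subr_eq addrC -scaleNr => /eqP->.
  by exists (Complex a (- b)); rewrite iotaE.
left=> y y0; have [a [b ab]] := gr0_quadratic y0; exists a.
have ya0 : y - a%:A \in c 0 by rewrite rpredB ?gr0_alg.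
have [b0|bn0] := eqVneq b 0.
  move: ab; rewrite b0 expr0n scale0r addr0 expr2.
  by case/gr0_mul_eq0 => // /eqP; rewrite subr_eq0 => /eqP.
case: noJ; exists (b^-1 *: (y - a%:A)); split; first by rewrite memvZ.
move/eqP: ab; rewrite addr_eq0 exprZn => /eqP->.
by rewrite scalerN scalerA -exprMn mulVf // expr1n scale1r.
Qed.

End IdentityComponent.

(** * Existence of a model *)

Import Order.TTheory Num.Theory.

Lemma rcf_root (R : rcfType) n (a : R) : (0 < n)%N -> 0 <= a ->
  exists x : R, x ^+ n = a.
Proof.
move=> n_gt0 a_ge0.
have a1 : 0 <= a + 1 by rewrite addr_ge0 ?ler01.
have [||x _ /rootP/eqP] := @poly_ivt R ('X^n - a%:P) 0 (a + 1) => //.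
  rewrite !hornerE expr0n gtn_eqF //= sub0r oppr_le0 a_ge0 /= subr_ge0.
  apply: (@le_trans _ _ (a + 1)); first by rewrite lerDl ler01.
  by apply: ler_eXnr => //; rewrite lerDr.
by rewrite !hornerE subr_eq0 => /eqP <-; exists x.
Qed.

Lemma complex_prim_root (R : rcfType) n : (0 < n)%N ->
  exists w : R[i], n.-primitive_root w.
Proof.
move=> n_gt0; have [s sE] := closed_field_poly_normal ('X^n - 1 : {poly R[i]}).
rewrite lead_coefXnsubC // scale1r in sE.
have s_uniq : uniq s.
  by rewrite -separable_prod_XsubC -sE separable_Xn_sub_1 // pnatr_eq0 -lt0n.
have : has n.-primitive_root s.
  apply: cyclic.has_prim_root => //.
    by apply/allP=> w; rewrite -root_prod_XsubC -sE.
  by rewrite -ltnS -(size_prod_XsubC s id) -sE size_XnsubC.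
by case/hasP=> w _; exists w.
Qed.

Section Existence.
Variables (R : realType) (A : gradedAlg R).
Hypotheses (Adiv : graded_division A) (Acomm : forall x y : A, x * y = y * x).
Local Notation T := (gr_group A).
Local Notation c := (@gr_comp R A).

Lemma exists_real_class :
    (forall y, y \in c 0 -> exists k : R, y = k%:A) ->
  exists p : gda_class, gr_equiv A (class_alg R p).
Proof.
move=> c0; have [s sT] := gr_support_finite (proj2 Adiv).
have [K K_gt0 TK] := finite_zmod_torsion sT.
(* If y has degree t then y ^+ K is a real number k.  With M = 2 K, the number
   y ^+ M = k ^+ 2 is positive, and y can be rescaled to an M-th root of 1. *)
pose M := (2 * K)%N; have M_gt0 : (0 < M)%N by rewrite muln_gt0.
have [E [deg [v EP]]] := root_group Adiv Acomm M_gt0.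
have deg_onto t : exists e, deg e = t.
  have [y yt yn0] := gr_neq0 Adiv t; have uy := gr_unit Adiv yt yn0.
  have [k yK] : exists k : R, y ^+ K = k%:A.
    by apply: c0; rewrite -(TK t) (grX Adiv).
  have kn0 : k != 0.
    by apply: contraTneq (unitrX K uy) => k0; rewrite yK k0 scale0r unitr0.
  have [r rM] := rcf_root M_gt0 (sqr_ge0 k).
  have rn0 : r != 0.
    apply: contra_neq kn0 => r0; apply/eqP; move: rM.
    by rewrite r0 expr0n gtn_eqF // => /esym/eqP; rewrite sqrf_eq0.
  have [||e <- _] := root_onto EP (g := t) (y := r^-1 *: y).
  - by rewrite memvZ.
  - have yM : y ^+ M = (k ^+ 2)%:A.
      by rewrite /M mulnC exprM yK exprZn expr1n.
    by rewrite exprZn yM scalerA -rM exprVn mulVf ?scale1r // expf_neq0.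
  by exists e.
have [||z deg_z vz] := root_onto EP (g := 0) (y := -1).
- by rewrite rpredN (gr1 Adiv).
- by rewrite exprM sqrrN !expr1n.
have z_neq0 : z != 0.
  apply/eqP=> z0; have /(fmorph_inj (in_alg A)) : in_alg A (-1) = in_alg A 1.
    by rewrite /= scaleN1r scale1r -vz z0 (root0 M_gt0 EP).
  by have := ltrN10 R => /[swap] ->; rewrite ltr10.
have z2 : z *+ 2 = 0.
  apply: (root_inj EP); first by rewrite raddfMn deg_z mul0rn raddf0.
  by rewrite (rootMn M_gt0 EP) vz (root0 M_gt0 EP) sqrrN expr1n.
have deg_ker : forall e, deg e = 0 <-> exists k, e = z *+ k.
  apply: (root_ker M_gt0 EP deg_z) => y /c0[k ->] kM.
  have : k ^+ 2 == 1.
    rewrite -(pexpr_eq1 (n := K)) ?sqr_ge0 // -exprM -/M.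
    by apply/eqP/(fmorph_inj (in_alg A)); rewrite rmorphXn /= kM scale1r.
  rewrite sqrf_eq1 vz => /orP[]/eqP->; first by exists 0%N; rewrite scale1r.
  by exists 1%N; rewrite scaleN1r.
have [[G [i bij_i]]|[m [x [G [i [alpha [m_gt0 xz bij_a alphaE]]]]]]] :=
    split_double_cover sT deg_onto z_neq0 z2 deg_ker.
  have [iota iotaE] := scalar_lrmorphism A.
  exists (RealGroupAlg G).
  apply: (equiv_groupAlg Adiv Acomm (iota := iota) (u := v \o i) _ _ _ bij_i).
  - exact: fmorph_inj.
  - by move=> a; rewrite iotaE memvZ // (gr1 Adiv).
  - by move=> y /c0[k ->]; exists k; rewrite iotaE.
  - by move=> g; apply: (root_deg EP).
  - by move=> g; apply: (root_unit M_gt0 EP).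
  - by move=> g h /=; rewrite raddfD (rootD EP).
exists (TwistedGroupAlg m_gt0 G).
apply: (equiv_twisted Adiv Acomm (x := v x) (u := v \o i) _ c0 bij_a).
- by rewrite alphaE /= raddf0 raddf0 addr0 mulr1n (root_deg EP).
- exact: (root_unit M_gt0 EP).
- by rewrite -(rootMn M_gt0 EP) xz vz scaleN1r.
- by move=> g; rewrite alphaE /= mulr0n add0r (root_deg EP).
- by move=> g; apply: (root_unit M_gt0 EP).
- by move=> g h /=; rewrite raddfD (rootD EP).
Qed.

Lemma exists_complex_class (iota : {lrmorphism Rcomplex R -> A}) :
    injective iota -> (forall a, iota a \in c 0) ->
    (forall y, y \in c 0 -> exists a, y = iota a) ->
  exists p : gda_class, gr_equiv A (class_alg R p).
Proof.
move=> iota_inj iota0 iota_onto; have [s sT] := gr_support_finite (proj2 Adiv).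
have [K K_gt0 TK] := finite_zmod_torsion sT.
(* The factor 2 ensures that M > 1, as 'Z_M requires, when T is trivial. *)
pose M := (2 * K)%N; have M_gt0 : (0 < M)%N by rewrite muln_gt0.
have M_gt1 : (1 < M)%N by rewrite -[2%N]muln1 leq_mul.
have TM (t : T) : t *+ M = 0 by rewrite /M mulnC mulrnA TK mul0rn.
have [w w_prim] := complex_prim_root R M_gt0.
have [E [deg [v EP]]] := root_group Adiv Acomm M_gt0.
have deg_onto t : exists e, deg e = t.
  have [y yt yn0] := gr_neq0 Adiv t; have uy := gr_unit Adiv yt yn0.
  have [a yM] : exists a, y ^+ M = iota a.
    by apply: iota_onto; rewrite -(TM t) (grX Adiv).
  pose b : Rcomplex R := M.-root (a : R[i]).
  have bM : b ^+ M = a by apply: rootCK.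
  have bn0 : b != 0.
    apply: contraTneq (unitrX M uy) => b0.
    by rewrite yM -bM b0 expr0n gtn_eqF // raddf0 unitr0.
  have [||e <- _] := root_onto EP (g := t) (y := iota b^-1 * y).
  - by rewrite -[t]add0r grM.
  - rewrite exprMn_comm; last exact: Acomm.
    by rewrite yM -rmorphXn -rmorphM exprVn bM mulVf ?rmorph1 // -bM expf_neq0.
  by exists e.
have [||z deg_z vz] := root_onto EP (g := 0) (y := iota w).
- exact: iota0.
- by rewrite -rmorphXn (prim_expr_order w_prim) rmorph1.
have EM (e : E) : e *+ M = 0.
  apply: (root_inj EP); first by rewrite raddfMn TM raddf0.
  by rewrite (rootMn M_gt0 EP) (root_expM EP) (root0 M_gt0 EP).
have deg_ker : forall e, deg e = 0 <-> exists k, e = z *+ k.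
  apply: (root_ker M_gt0 EP deg_z) => _ /iota_onto[a ->] iaM.
  have aM : (a : R[i]) ^+ M = 1.
    by apply: iota_inj; rewrite rmorphXn /= iaM rmorph1.
  by have [k ->] := prim_rootP w_prim aM; exists k; rewrite vz rmorphXn.
have zM k (y : E) : z *+ k = y *+ M -> (M %| k)%N.
  rewrite EM => zk; rewrite (prim_order_dvd w_prim); apply/eqP/iota_inj.
  by rewrite rmorphXn /= -vz -(rootMn M_gt0 EP) zk (root0 M_gt0 EP) rmorph1.
have [G [i bij_i]] := split_extension sT deg_onto M_gt1 (EM z) deg_ker zM.
exists (ComplexGroupAlg G).
apply: (equiv_groupAlg Adiv Acomm (iota := iota) (u := v \o i) _ _ _ bij_i)
  => //.
- by move=> g; apply: (root_deg EP).
- by move=> g; apply: (root_unit M_gt0 EP).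
- by move=> g h /=; rewrite raddfD (rootD EP).
Qed.

End Existence.

(** * Uniqueness *)

(** Equivalences transport this relation, which distinguishes the models. *)
Definition gr_root (F : fieldType) (A : gradedAlg F) (g : gr_group A) m :=
  exists2 x, x \in gr_comp g & x ^+ (2 ^ m) = -1.

Lemma gr_equiv_root (F : fieldType) (A B : gradedAlg F) : gr_equiv A B ->
  exists2 alpha : {additive gr_group A -> gr_group B}, bijective alpha &
    forall g m, gr_root g m <-> gr_root (alpha g) m.
Proof.
case=> phi [alpha [phi_bij alpha_bij phi_comp]]; exists alpha => // g m; split.
  case=> x xg xm; exists (phi x); first by rewrite -phi_comp memv_img.
  by rewrite -rmorphXn xm rmorphN1.
case=> y; rewrite -phi_comp => /memv_imgP[x xg ->] xm; exists x => //.
by apply: (bij_inj phi_bij); rewrite rmorphXn rmorphN1.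
Qed.

Lemma gsingleX (F : fieldType) (K : falgType F) (G : finZmodType) (g : G)
    (a : K) k : gsingle (F := F) g a ^+ k = gsingle (g *+ k) (a ^+ k).
Proof.
elim: k => [|k IH]; first by rewrite mulr0n.
by rewrite exprS IH gsingleM mulrS exprS.
Qed.

Lemma tensX (F : fieldType) (A B : falgType F) (a : A) (b : B) k :
  tens a b ^+ k = tens (a ^+ k) (b ^+ k).
Proof. by elim: k => // k IH; rewrite !exprS IH tensM. Qed.

Lemma tens_eq0 (F : fieldType) (A B : falgType F) (a : A) (b : B) :
  a != 0 -> tens a b = 0 -> b = 0.
Proof.
move=> an0 ab0; rewrite (coord_vbasis (memvf b)); apply: big1 => j _.
have [i ai] : exists i, coord (vbasis {:A}) i a != 0.
  apply/existsP; apply: contraNT an0 => /existsPn a0.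
  rewrite (coord_vbasis (memvf a)) big1 // => i _.
  by have := a0 i; rewrite negbK => /eqP->; rewrite scale0r.
move/matrixP/(_ i j)/eqP: ab0; rewrite !mxE mulf_eq0 (negPf ai) /= => /eqP->.
by rewrite scale0r.
Qed.

Section ClassInvariants.
Variable R : realType.

(** The coefficient at 0 of the left-hand side is 0 or a. *)
Lemma real_groupAlg_positive (G : finZmodType) (h : G) (a : R) :
  0 <= a -> gsingle (F := R) h (a : R^o) != -1.
Proof.
move=> a0; apply/eqP=> /ffunP/(_ 0); rewrite !ffunE eqxx.
case: eqP => _ a1.
  by have := lt_le_trans (ltrN10 R) a0; rewrite -a1 ltxx.
by have := ltrN10 R; rewrite -a1 ltxx.
Qed.

Lemma real_root (G : finZmodType) (g : G) m :
  gr_root (A := gr_groupAlg R^o G) g m -> m = 0%N.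
Proof.
case=> _ /groupAlg_compP[a ->]; case: m => // m /eqP.
rewrite gsingleX (negPf (real_groupAlg_positive _ _)) //.
by rewrite expnS exprM exprn_ge0 // sqr_ge0.
Qed.

Lemma complex_root (G : finZmodType) :
  gr_root (A := gr_groupAlg (Rcomplex R) G) 0 1.
Proof.
exists (gsingle 0 ('i%C : Rcomplex R)).
  by apply/groupAlg_compP; exists 'i%C.
rewrite gsingleX mul0rn.
have -> : ('i%C : Rcomplex R) ^+ (2 ^ 1) = -1 by apply: sqr_i.
by rewrite linearN.
Qed.

Section Twisted.
Variables (m : nat) (m_gt0 : (0 < m)%N) (G : finZmodType).
Local Notation B := (class_alg R (TwistedGroupAlg m_gt0 G)).

Lemma twisted_comp (p : gr_group B) x : x \in gr_comp p ->
  exists l : R, x =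
    l *: tens (cycAlgX (2 ^ m) (-1 : R) ^+ (p.1 : 'Z__))
              (gsingle p.2 (1 : R^o)).
Proof.
by case: p => k g; rewrite /= /tensor_comp /= groupAlg_comp_line => /tensv_line.
Qed.

Lemma twisted_has_root : exists g, gr_root (A := B) g m.
Proof.
exists (1, 0); exists (tens (cycAlgX (2 ^ m) (-1 : R)) (gsingle 0 (1 : R^o))).
  apply: memv_tens; last by apply/groupAlg_compP; exists 1.
  exact: memv_line.
rewrite tensX cycAlgXn ?expn2_gt1 // gsingleX mul0rn expr1n.
by rewrite tensZl scaleN1r.
Qed.

Lemma twisted_positive (h : G) (a : R) : 0 <= a ->
  a *: tens (1 : cycAlg (2 ^ m) (-1 : R)) (gsingle h (1 : R^o)) != -1.
Proof.
move=> a0; rewrite -addr_eq0.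
have -> : a *: tens (1 : cycAlg (2 ^ m) (-1 : R)) (gsingle h (1 : R^o)) + 1 =
    tens 1 (gsingle h (a : R^o) + 1).
  rewrite linearD; congr (_ + _); rewrite -linearZ; congr tens.
  by rewrite -linearZ /= [a *: _]mulr1.
apply/eqP=> /tens_eq0; rewrite oner_eq0 => /(_ isT)/eqP; rewrite addr_eq0.
by rewrite (negPf (real_groupAlg_positive _ _)).
Qed.

(** An element of the component of (k, g) is a real multiple of the tensor of
    X^k and of g; for j > m, its 2^j-th power is a nonnegative multiple of an
    element of G, as X^(2^j) = 1, and cannot be -1. *)
Lemma twisted_root_le (g : gr_group B) j : gr_root g j -> (j <= m)%N.
Proof.
case=> x /twisted_comp[l ->] xj; rewrite leqNgt; apply/negP=> mj.
have X1 : cycAlgX (2 ^ m) (-1 : R) ^+ (g.1 : 'Z__) ^+ (2 ^ j) = 1.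
  rewrite -exprM mulnC -(subnKC mj) expnD expnSr -!mulnA !exprM.
  by rewrite cycAlgXn ?expn2_gt1 // scaleN1r sqrrN !expr1n.
move: xj; rewrite exprZn tensX gsingleX expr1n X1 => /eqP.
rewrite (negPf (twisted_positive _ _)) // -(subnKC mj) addSn expnS exprM.
by rewrite exprn_ge0 // sqr_ge0.
Qed.

Lemma twisted_no_root0 : ~ gr_root (A := B) 0 1.
Proof.
case=> x /twisted_comp[l ->] /eqP; rewrite /= expr0 exprZn tensX gsingleX.
rewrite !expr1n.
by rewrite (negPf (twisted_positive _ _)) // sqr_ge0.
Qed.

End Twisted.

(** The kind of the model and the integer m are read off gr_root: whether -1 has
    a square root in degree 0, and how often -1 has iterated homogeneous square
    roots.  The group is then obtained from the support of A. *)
Lemma same_class_unique (A : gradedAlg R) (p q : gda_class) :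
  gr_equiv A (class_alg R p) -> gr_equiv A (class_alg R q) -> same_class p q.
Proof.
move=> /gr_equiv_root[a a_bij aP] /gr_equiv_root[b b_bij bP].
have iso : group_iso (gr_group (class_alg R p)) (gr_group (class_alg R q)).
  apply: (group_iso_trans (H := gr_group A)); last by exists b.
  by apply: group_iso_sym; exists a.
have pq g j : gr_root (A := class_alg R p) g j ->
    exists h, gr_root (A := class_alg R q) h j.
  have [a' a'K aK'] := additive_inverse a_bij.
  by rewrite -[g]aK' => /aP/bP; exists (b (a' g)).
have qp g j : gr_root (A := class_alg R q) g j ->
    exists h, gr_root (A := class_alg R p) h j.
  have [b' b'K bK'] := additive_inverse b_bij.
  by rewrite -[g]bK' => /bP/aP; exists (a (b' g)).
have pq0 j :
    gr_root (A := class_alg R p) 0 j <-> gr_root (A := class_alg R q) 0 j.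
  by rewrite -(raddf0 a) -(raddf0 b) -bP -aP.
case: p q iso pq qp pq0 {a a_bij aP b b_bij bP} =>
    [G|G|m m_gt0 G] [H|H|k k_gt0 H] //= iso pq qp pq0.
- by have /pq0/real_root := complex_root H.
- have [g gm] := twisted_has_root k_gt0 H; have [h /real_root k0] := qp _ _ gm.
  by have := k_gt0; rewrite k0.
- by have /pq0/real_root := complex_root G.
- by have /pq0/twisted_no_root0 := complex_root G.
- have [g gm] := twisted_has_root m_gt0 G; have [h /real_root k0] := pq _ _ gm.
  by have := m_gt0; rewrite k0.
- by have /pq0/twisted_no_root0 := complex_root H.
have mk : m = k.
  apply/eqP; rewrite eqn_leq.
  have [g /pq[h /twisted_root_le->]] := twisted_has_root m_gt0 G.
  by have [g' /qp[h' /twisted_root_le->]] := twisted_has_root k_gt0 H.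
split=> //.
have cancel l : m = l ->
    group_iso ('Z_(2 ^ m) * G)%type ('Z_(2 ^ l) * H)%type -> group_iso G H.
  by move=> <-; apply: cancel_Zp2.
exact: cancel mk iso.
Qed.

End ClassInvariants.

Theorem theorem6p4 (R : realType) (A : gradedAlg R)
    (Adiv : graded_division A)
    (Acomm : forall x y : A, x * y = y * x) :
  exists2 p : gda_class, gr_equiv A (class_alg R p) &
    forall q : gda_class, gr_equiv A (class_alg R q) -> same_class p q.
Proof.
have [p Ap] : exists p, gr_equiv A (class_alg R p).
  have [c0|[iota [iota_inj iota0 iota_onto]]] := gr0_real_or_complex Adiv Acomm.
    exact: exists_real_class.
  exact: exists_complex_class iota_inj iota0 iota_onto.
by exists p => // q; apply: same_class_unique.
Qed.
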